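(* Given a geometrically consistent dimer model (on a torus) with associated quiver $Q$, for all vertices $i,j$ in the universal cover $\widetilde{Q}$ of $Q$ there exists an (oriented) path from $i$ to $j$ which avoids some extremal perfect matching, i.e. a path on which some extremal perfect matching evaluates to zero.
   Context: **Dimer model and quiver.** A dimer model is a finite bipartite tiling of a compact oriented surface $Y$: a finite polygonal cell decomposition whose vertices (all of valence at least 2) are coloured black and white so that every edge joins a black vertex to a white vertex. It is a dimer model on a torus if $Y=T$ is the 2-torus. The associated quiver $Q$ is the dual cell decomposition: its set of vertices $Q_0$ is dual to the tiles, its set of arrows $Q_1$ is dual to the edges, and its set of faces $Q_2$ is dual to the dimer vertices; each arrow is oriented so that the black dimer vertex is on its left and the white one on its right. Boundaries of faces are oriented cycles of arrows. An arrow $a$ has tail $ta$ and head $ha$. $\widetilde{Q}$ denotes the lift of $Q$ to the universal cover (the plane) of $T$. **Perfect matchings.** $\mathbb{Z}^{Q_i}$ denotes integer functions on $Q_i$. Let $d:\mathbb{Z}^{Q_0}\to\mathbb{Z}^{Q_1}$, $(dg)(a)=g(ha)-g(ta)$, and $d:\mathbb{Z}^{Q_1}\to\mathbb{Z}^{Q_2}$, $(dv)(f)=\sum_{a\in\partial f}v(a)$. Let $\underline{1}\in\mathbb{Z}^{Q_2}$ be the constant function 1 and $N=\{v\in\mathbb{Z}^{Q_1}: dv\in\mathbb{Z}\underline{1}\}$. A perfect matching is an element $\pi\in\mathbb{N}^{Q_1}$ with $d\pi=\underline{1}$ (so $\pi$ takes values in $\{0,1\}$ and equals 1 on exactly one arrow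 of each face boundary). It evaluates on a path in $\widetilde{Q}$ by summing the values of $\pi$ over the projections to $Q$ of the arrows of the path. Let $N_o=N/d(\mathbb{Z}^{Q_0})$ (a rank 3 lattice). The images of the perfect matchings in $N_o$ lie in a rank 2 affine sublattice (the degree 1 elements, degree of $v$ being the $\lambda$ with $dv=\lambda\underline{1}$), and their convex hull is a lattice polygon. A perfect matching is extremal if its image is a vertex of this polygon. **Geometric consistency.** For a dimer model on $T$, the quad graph is the tiling of $T$ whose vertices are the dimer vertices together with the quiver vertices, with edges connecting a dimer vertex $f$ to a quiver vertex $v$ when the quiver face dual to $f$ has $v$ in its boundary; its faces are quadrilaterals (quads), in bijection with $Q_1$, the quad of $a$ having as its corners $ta$, $ha$ and the two dimer vertices joined by the edge dual to $a$. The dimer model is geometrically consistent if, for some flat metric on the torus, its quad graph has a rhombic embedding, i.e. an embedding in the torus such that all edges are line segments of the same length (so that each quad is a rhombus). *)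

(* Defs.v *)
From HB Require Import structures.
From mathcomp Require Import all_boot all_order all_algebra.
From mathcomp Require Import reals.

Set Implicit Arguments.
Unset Strict Implicit.
Unset Printing Implicit Defensive.

Import Order.TTheory GRing.Theory Num.Theory.
Local Open Scope ring_scope.

(** * Bipartite tilings of oriented surfaces, described by their quivers

  The cell decomposition is encoded by the permutations of the set [A] of
  arrows (= dimer edges) that it induces:
  - [nextb a] follows [a] in the boundary of the face on the left of [a], the
    one dual to the black end [bl a] of the edge dual to [a];
  - [nextw a] follows [a] in the boundary of the face on the right of [a], the
    one dual to the white end [wh a];
  - [rot a] is the next arrow with tail [tl a], counterclockwise around [tl a].
  At the head of [a], the boundary arrows are met counterclockwise in the order
  [nextb a] (out), [a] (in), [nextw a] (out), whence [nextwE].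
  Black faces, white faces and quiver vertices (= tiles) are the orbits of
  [nextb], [nextw] and [rot].  The orbit axioms also force these maps to be
  bijective with finite orbits, so all cells are polygons; [A] itself may be
  infinite, since the same notion is used for the universal cover. *)
Record tiling (V A B W : Type) := Tiling {
  tl : A -> V;
  bl : A -> B;
  wh : A -> W;
  nextb : A -> A;
  nextw : A -> A;
  rot : A -> A;
  nextwE : forall a, nextw a = rot (nextb a);
  tlP : forall a a', tl a = tl a' <-> exists n, iter n rot a = a';
  blP : forall a a', bl a = bl a' <-> exists n, iter n nextb a = a';
  whP : forall a a', wh a = wh a' <-> exists n, iter n nextw a = a';
  tl_surj : forall v, exists a, tl a = v;
  bl_surj : forall b, exists a, bl a = b;
  wh_surj : forall w, exists a, wh a = w }.

Definition hd V A B W (T : tiling V A B W) (a : A) : V := tl T (nextb T a).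

(** ** Walks and homotopy

  A step [(true, a)] traverses [a] from tail to head, [(false, a)] from head
  to tail. *)
Section Homotopy.
Variables (V A B W : Type) (T : tiling V A B W).

Definition step_src (s : bool * A) : V := if s.1 then tl T s.2 else hd T s.2.
Definition step_dst (s : bool * A) : V := if s.1 then hd T s.2 else tl T s.2.
Definition step_inv (s : bool * A) : bool * A := (~~ s.1, s.2).

Fixpoint walk (i : V) (w : seq (bool * A)) (j : V) : Prop :=
  if w is s :: w' then step_src s = i /\ walk (step_dst s) w' j else i = j.

Definition forward (p : seq A) : seq (bool * A) := [seq (true, a) | a <- p].

Definition oriented_path (i : V) (p : seq A) (j : V) : Prop :=
  walk i (forward p) j.

Inductive homotopic (i j : V) : seq (bool * A) -> seq (bool * A) -> Prop :=
| homotopic_refl w : walk i w j -> homotopic i j w w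
| homotopic_sym w w' : homotopic i j w w' -> homotopic i j w' w
| homotopic_trans w1 w2 w3 :
    homotopic i j w1 w2 -> homotopic i j w2 w3 -> homotopic i j w1 w3
| homotopic_cancel w1 s w2 :
    walk i (w1 ++ [:: s; step_inv s] ++ w2) j ->
    homotopic i j (w1 ++ [:: s; step_inv s] ++ w2) (w1 ++ w2)
| homotopic_black w1 a n w2 : iter n (nextb T) a = a ->
    walk i (w1 ++ forward (traject (nextb T) a n) ++ w2) j ->
    homotopic i j (w1 ++ forward (traject (nextb T) a n) ++ w2) (w1 ++ w2)
| homotopic_white w1 a n w2 : iter n (nextw T) a = a ->
    walk i (w1 ++ forward (traject (nextw T) a n) ++ w2) j ->
    homotopic i j (w1 ++ forward (traject (nextw T) a n) ++ w2) (w1 ++ w2).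

Definition connected : Prop := forall i j, exists w, walk i w j.

Definition simply_connected : Prop :=
  forall i w, walk i w i -> homotopic i i w [::].

End Homotopy.

(** ** Covering maps

  Vertices and faces being orbits of arrows, a map of tilings is determined by
  its effect on arrows. *)
Section Maps.
Variables (V A B W V' A' B' W' : Type).
Variables (T : tiling V A B W) (T' : tiling V' A' B' W').

Definition tiling_map (f : A -> A') : Prop :=
  (forall a, f (nextb T a) = nextb T' (f a)) /\
  (forall a, f (rot T a) = rot T' (f a)).

(* The last three clauses say that the map is unramified at the quiver
   vertices and at the centres of the black and of the white faces. *)
Definition covering (f : A -> A') : Prop :=
  [/\ tiling_map f,
      forall a', exists a, f a = a',
      forall a1 a2, tl T a1 = tl T a2 -> f a1 = f a2 -> a1 = a2,
      forall a1 a2, bl T a1 = bl T a2 -> f a1 = f a2 -> a1 = a2 &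
      forall a1 a2, wh T a1 = wh T a2 -> f a1 = f a2 -> a1 = a2].

End Maps.

(** * Dimer models *)

Record dimer_model := DimerModel {
  Q0 : finType;
  Q1 : finType;
  Qblack : finType;
  Qwhite : finType;
  quiver :> tiling Q0 Q1 Qblack Qwhite;
  black_valence : forall a, nextb quiver a <> a;
  white_valence : forall a, nextw quiver a <> a }.

Definition Q2 (Q : dimer_model) : Type := (Qblack Q + Qwhite Q)%type.

(* The connected compact oriented surface of Euler characteristic 0; the tiling
   has Q2 as vertices, Q1 as edges and Q0 as tiles. *)
Definition on_torus (Q : dimer_model) : Prop :=
  [/\ (0 < #|Q1 Q|)%N, connected Q &
      (#|Qblack Q| + #|Qwhite Q| + #|Q0 Q| = #|Q1 Q|)%N].

Record universal_cover (Q : dimer_model) := UniversalCover {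
  U0 : Type;
  U1 : Type;
  Ublack : Type;
  Uwhite : Type;
  lift :> tiling U0 U1 Ublack Uwhite;
  proj : U1 -> Q1 Q;
  proj_covering : covering lift Q proj;
  lift_connected : connected lift;
  lift_simply_connected : simply_connected lift }.

Definition deck (Q : dimer_model) (U : universal_cover Q) (g : U1 U -> U1 U) :
    Prop :=
  [/\ tiling_map U U g, bijective g & forall a, proj (g a) = proj a].

(** * Perfect matchings *)
Section Matchings.
Variable Q : dimer_model.

Definition d0 (M : zmodType) (g : {ffun Q0 Q -> M}) : {ffun Q1 Q -> M} :=
  [ffun a => g (hd Q a) - g (tl Q a)].

Definition d1 (M : nmodType) (v : {ffun Q1 Q -> M}) (f : Q2 Q) : M :=
  match f with
  | inl b => \sum_(a | bl Q a == b) v a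
  | inr w => \sum_(a | wh Q a == w) v a
  end.

Definition perfect_matching (pi : {ffun Q1 Q -> nat}) : Prop :=
  forall f, d1 pi f = 1%N.

Definition eval_path (U : universal_cover Q) (pi : {ffun Q1 Q -> nat})
    (p : seq (U1 U)) : nat :=
  (\sum_(a <- p) pi (proj a))%N.

Section Polygon.
Variable R : realType.

(* The polygon lives in N_o (x) R = N_R / d(R^Q0), where N_R is the space of
   v in R^Q1 with dv constant.  Classes are handled through representatives in
   R^Q1: [same_class] is equality modulo d(R^Q0).  Convex combinations of
   perfect matchings lie in N_R. *)
Definition same_class (x y : {ffun Q1 Q -> R}) : Prop :=
  exists g : {ffun Q0 Q -> R}, x - y = d0 g.

Definition realify (pi : {ffun Q1 Q -> nat}) : {ffun Q1 Q -> R} :=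
  [ffun a => (pi a)%:R].

Definition in_polygon (x : {ffun Q1 Q -> R}) : Prop :=
  exists (n : nat) (m : 'I_n -> {ffun Q1 Q -> nat}) (c : 'I_n -> R),
    [/\ forall k, perfect_matching (m k),
        forall k, 0 <= c k,
        \sum_k c k = 1 &
        same_class x [ffun a => \sum_k c k * realify (m k) a]].

Definition polygon_vertex (x : {ffun Q1 Q -> R}) : Prop :=
  in_polygon x /\
  forall (y z : {ffun Q1 Q -> R}) (t : R),
    in_polygon y -> in_polygon z -> 0 < t < 1 ->
    same_class x [ffun a => t * y a + (1 - t) * z a] ->
    same_class y x /\ same_class z x.

Definition extremal (pi : {ffun Q1 Q -> nat}) : Prop :=
  perfect_matching pi /\ polygon_vertex (realify pi).

End Polygon.
End Matchings.

(** * Quad graph and rhombic embeddings *)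
Section QuadGraph.
Variables (V A B W : Type) (T : tiling V A B W).

Inductive quad_vertex :=
| QuiverVertex of V
| BlackVertex of B
| WhiteVertex of W.

(* The corner of a face between an arrow a and its successor is at the head of
   a, so the quad edges ending at black (resp. white) dimer vertices are indexed
   by arrows: [BlackEdge a] joins bl a and hd a, [WhiteEdge a] joins wh a and
   hd a. *)
Inductive quad_cell :=
| Vertex of quad_vertex
| BlackEdge of A
| WhiteEdge of A
| Quad of A.

(* The corners of a quad are listed counterclockwise. *)
Definition corners (c : quad_cell) : seq quad_vertex :=
  match c with
  | Vertex x => [:: x]
  | BlackEdge a => [:: BlackVertex (bl T a); QuiverVertex (hd T a)]
  | WhiteEdge a => [:: WhiteVertex (wh T a); QuiverVertex (hd T a)]
  | Quad a => [:: QuiverVertex (tl T a); WhiteVertex (wh T a);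
                  QuiverVertex (hd T a); BlackVertex (bl T a)]
  end.

Variables (R : realType) (p : quad_vertex -> 'rV[R]_2).

Definition open_cell (c : quad_cell) (x : 'rV[R]_2) : Prop :=
  exists s : seq R,
    [/\ size s = size (corners c), all (fun r => 0 < r) s,
        \sum_(r <- s) r = 1 &
        x = \sum_(z <- zip s (corners c)) z.1 *: p z.2].

End QuadGraph.

Definition length2 (R : realType) (x : 'rV[R]_2) : R :=
  Num.sqrt (\sum_j x 0 j ^+ 2).

Definition det2 (R : realType) (x y : 'rV[R]_2) : R :=
  x 0 0 * y 0 1 - x 0 1 * y 0 0.

Definition acts_by_translation (R : realType) (V A B W : Type)
    (T : tiling V A B W) (p : quad_vertex V B W -> 'rV[R]_2) (g : A -> A)
    (x : 'rV[R]_2) : Prop :=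
  forall a,
    [/\ p (QuiverVertex _ _ (tl T (g a))) = p (QuiverVertex _ _ (tl T a)) + x,
        p (BlackVertex _ _ (bl T (g a))) = p (BlackVertex _ _ (bl T a)) + x &
        p (WhiteVertex _ _ (wh T (g a))) = p (WhiteVertex _ _ (wh T a)) + x].

(* The torus with a flat metric is R^2 / L for the lattice L spanned by [e1],
   [e2]; its universal cover is the Euclidean plane, the deck transformations
   acting as the translations by L.  An embedding of the quad graph of the
   torus, as a tiling of R^2 / L, is given by its lift [p] to the plane: it is
   equivariant, and the vertices, open edges (segments) and open quads of the
   lifted quad graph partition the plane.  As the torus is oriented, the
   identification with R^2 / L preserves the orientation. *)
Record rhombic_embedding (R : realType) (Q : dimer_model)
    (U : universal_cover Q) (e1 e2 : 'rV[R]_2) (len : R)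
    (p : quad_vertex (U0 U) (Ublack U) (Uwhite U) -> 'rV[R]_2) : Prop := {
  lattice_basis : det2 e1 e2 != 0;
  deck_translation : forall g, deck g -> exists m n : int,
    acts_by_translation U p g (e1 *~ m + e2 *~ n);
  translation_deck : forall m n : int, exists g,
    deck g /\ acts_by_translation U p g (e1 *~ m + e2 *~ n);
  length_pos : 0 < len;
  black_edge_length : forall a,
    length2 (p (BlackVertex _ _ (bl U a)) - p (QuiverVertex _ _ (hd U a)))
      = len;
  white_edge_length : forall a,
    length2 (p (WhiteVertex _ _ (wh U a)) - p (QuiverVertex _ _ (hd U a)))
      = len;
  cells_partition_plane : forall x, exists! c, open_cell U p c x;
  quads_oriented : forall a,
    0 < det2 (p (WhiteVertex _ _ (wh U a)) - p (QuiverVertex _ _ (tl U a)))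
             (p (BlackVertex _ _ (bl U a)) - p (QuiverVertex _ _ (tl U a))) }.

Definition geometrically_consistent (R : realType) (Q : dimer_model) : Prop :=
  exists (U : universal_cover Q) (e1 e2 : 'rV[R]_2) (len : R)
    (p : quad_vertex (U0 U) (Ublack U) (Uwhite U) -> 'rV[R]_2),
    rhombic_embedding e1 e2 len p.

(* Main.v *)
(* Idea.  In the rhombic tiling of the plane call a strip a maximal chain of
   rhombi in which consecutive rhombi share an edge with one fixed vector; a
   strip is periodic, two-sided and crosses the quad graph edges of that vector.

   For a direction u parallel to no edge, the arrows a whose two edge vectors at
   the tail (to the white and to the black dimer vertex) lie strictly to the left
   of u form a perfect matching, because exactly one corner of each face points
   in the direction u or -u.  A quad graph path all of whose steps lie to the
   right of u can be pushed to an oriented path avoiding this matching: at each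
   face it can be replaced by the arc of the boundary which runs in the
   orientation of the arrows.

   A shortest quad graph path from i to j crosses exactly the strips separating i
   from j, each once, so it is descending for u as soon as u is to the correct
   side of each of these crossings.  The crossing directions are controlled
   through the periods of the strips: the oriented periods of the strips
   separating i from j contain no opposite pair and no positively spanning
   triple, as three such strips would bound a triangle separating neither i nor
   j.  Hence some lattice vector T pairs positively with all of them; perturbing
   T, it orients all strips, and as strips cross in the cyclic order of their
   periods there is a u for which all strips are descended in the sense of T.
   With this u one also descends from j to i + mT for m large, hence a single
   matching is avoided by a path from i to j and by a closed path in Q extending
   it.  The closed path is a linear function on the polygon, nonnegative and with
   zeros, so it vanishes at some vertex. *)

From HB Require Import structures.
From mathcomp Require Import all_boot all_order all_algebra.
From mathcomp Require Import boolp reals ring lra zify.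
Require Import Defs.

Set Implicit Arguments.
Unset Strict Implicit.
Unset Printing Implicit Defensive.

Import Order.TTheory GRing.Theory Num.Theory.
Local Open Scope ring_scope.

(** * Vectors in the plane: wedge products and half planes *)

Section Plane.
Variable F : realDomainType.
Implicit Types x y z t : F * F.

Definition wedge x y : F := x.1 * y.2 - x.2 * y.1.
Definition dot x y : F := x.1 * y.1 + x.2 * y.2.
Definition perp x : F * F := (x.2, - x.1).

Lemma wedgeC x y : wedge x y = - wedge y x.
Proof. by rewrite /wedge; ring. Qed.

Lemma wedgexx x : wedge x x = 0.
Proof. by rewrite /wedge; ring. Qed.

Lemma wedgeDr x y z : wedge x (y + z) = wedge x y + wedge x z.
Proof. by rewrite /wedge /=; ring. Qed.

Lemma wedgeDl x y z : wedge (x + y) z = wedge x z + wedge y z.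
Proof. by rewrite /wedge /=; ring. Qed.

Lemma wedgeNr x y : wedge x (- y) = - wedge x y.
Proof. by rewrite /wedge /=; ring. Qed.

Lemma wedgeNl x y : wedge (- x) y = - wedge x y.
Proof. by rewrite /wedge /=; ring. Qed.

Lemma wedgeBl x y z : wedge (x - y) z = wedge x z - wedge y z.
Proof. by rewrite wedgeDl wedgeNl. Qed.

Lemma wedge0r x : wedge x 0 = 0.
Proof. by rewrite /wedge /=; ring. Qed.

Lemma wedge0l x : wedge 0 x = 0.
Proof. by rewrite /wedge /=; ring. Qed.

Lemma wedgeMnl x y n : wedge (x *+ n) y = wedge x y *+ n.
Proof. by elim: n => [|n IH]; rewrite ?mulr0n ?wedge0l // !mulrS wedgeDl IH. Qed.

Lemma wedgeMnr x y n : wedge x (y *+ n) = wedge x y *+ n.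
Proof. by elim: n => [|n IH]; rewrite ?mulr0n ?wedge0r // !mulrS wedgeDr IH. Qed.

Lemma wedge_perp x y : wedge (perp x) y = dot x y.
Proof. by rewrite /wedge /dot /perp /=; ring. Qed.

Lemma dot_gt0 x : x != 0 -> 0 < dot x x.
Proof.
case: x => a b ab0; rewrite /dot /= -!expr2.
rewrite lt0r addr_ge0 ?sqr_ge0 // andbT paddr_eq0 ?sqr_ge0 //.
by rewrite !sqrf_eq0; apply: contraNN ab0 => /andP[/eqP -> /eqP ->].
Qed.

Lemma wedge_neq0l x y : wedge x y != 0 -> x != 0.
Proof. by apply: contraNneq => ->; rewrite wedge0l. Qed.

Lemma wedge_neq0r x y : wedge x y != 0 -> y != 0.
Proof. by apply: contraNneq => ->; rewrite wedge0r. Qed.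

(** Cramer's rule: the combination of [x], [y], [z] with coefficients [wedge y z], [wedge z x],
    [wedge x y] is zero, and it is wedged here with [t]. *)
Lemma cramer x y z t :
  wedge x y * wedge t z + wedge y z * wedge t x + wedge z x * wedge t y = 0.
Proof. by rewrite /wedge; ring. Qed.

(* [dot y y * z = dot y z * y] when [z] is parallel to [y]. *)
Lemma wedge_parallel x y z : wedge y z = 0 ->
  dot y y * wedge x z = dot y z * wedge x y.
Proof.
move=> yz0; have : dot y y * wedge x z - dot y z * wedge x y =
  dot x y * wedge y z by rewrite /wedge /dot; ring.
by rewrite yz0 mulr0 => /subr0_eq.
Qed.

Lemma wedge_same_dir x y z : wedge y z = 0 -> 0 < dot y z ->
  (0 < wedge x z) = (0 < wedge x y).
Proof.
move=> yz0 yzp; have y0 : y != 0.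
  by apply: contraTneq yzp => ->; rewrite /dot /= !mul0r addr0 ltxx.
by rewrite -(pmulr_rgt0 _ (dot_gt0 y0)) wedge_parallel // pmulr_rgt0.
Qed.

Lemma dotC x y : dot x y = dot y x.
Proof. by rewrite /dot; ring. Qed.

(** The three minimal obstructions to lying in an open half plane bounded by a line through the
    origin: the zero vector, an opposite pair, and a triple winding around the origin. *)
Definition half_planar (P : F * F -> Prop) : Prop :=
  [/\ forall x, P x -> x != 0,
      forall x y, P x -> P y -> wedge x y = 0 -> 0 < dot x y &
      forall x y z, P x -> P y -> P z ->
        0 < wedge x y -> 0 < wedge y z -> 0 < wedge z x -> False].

(** If a new vector [x] is strictly clockwise of the current extreme [y], it becomes extreme: a [z]
    strictly clockwise of [x] would make [x], [y], [z] wind around the origin, or be parallel to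
    [y]. *)
Lemma rightmost (P : F * F -> Prop) (l : seq (F * F)) :
  half_planar P -> (forall x, x \in l -> P x) -> l != [::] ->
  exists2 y, y \in l & forall x, x \in l -> 0 <= wedge y x.
Proof.
move=> [P0 P2 P3]; elim: l => // x l IH Pl _.
have Px : P x by apply: Pl; rewrite mem_head.
have {}Pl z : z \in l -> P z by move=> zl; apply: Pl; rewrite inE zl orbT.
have [->|l0] := eqVneq l [::].
  by exists x; rewrite ?mem_head // => z; rewrite inE => /eqP ->; rewrite wedgexx.
have [y yl ymin] := IH Pl l0.
have [yx|xy] := lerP 0 (wedge y x).
  exists y; first by rewrite inE yl orbT.
  by move=> z; rewrite inE => /predU1P[-> //|/ymin].
exists x; first exact: mem_head.
move=> z; rewrite inE => /predU1P[->|zl]; first by rewrite wedgexx.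
rewrite leNgt; apply/negP => xz.
have xy' : 0 < wedge x y by rewrite wedgeC oppr_gt0.
have zx' : 0 < wedge z x by rewrite wedgeC oppr_gt0.
have := ymin z zl; rewrite le_eqVlt => /predU1P[/esym yz|yz].
  have yzp := P2 y z (Pl y yl) (Pl z zl) yz.
  have := wedge_same_dir x yz yzp; rewrite xy' => xz'.
  by move: xz; rewrite ltNge (ltW xz').
exact: P3 Px (Pl _ yl) (Pl _ zl) xy' yz zx'.
Qed.

End Plane.

Section HalfPlane.
Variable F : realDomainType.
Implicit Types x y z t : F * F.

Let swap x : F * F := (x.2, x.1).

(** The mirror image of [rightmost] under the exchange of coordinates, which reverses the sign of
    [wedge]. *)
Lemma leftmost (P : F * F -> Prop) (l : seq (F * F)) :
  half_planar P -> (forall x, x \in l -> P x) -> l != [::] ->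
  exists2 y, y \in l & forall x, x \in l -> 0 <= wedge x y.
Proof.
move=> [P0 P2 P3] Pl l0.
have wsw x y : wedge (swap x) (swap y) = wedge y x by rewrite /wedge /=; ring.
have dsw x y : dot (swap x) (swap y) = dot x y by rewrite /dot /=; ring.
have swK x : swap (swap x) = x by case: x.
have : half_planar (fun x => P (swap x)).
  split=> [x /P0|x y Px Py|x y z Px Py Pz].
  - by apply: contraNneq => ->.
  - by rewrite -dsw -[x in wedge x]swK -[y in wedge _ y]swK wsw wedgeC => /eqP;
      rewrite oppr_eq0 => /eqP; apply: P2.
  rewrite -[x in wedge x]swK -[y in wedge _ y]swK wsw => xy.
  rewrite -[y in wedge y]swK -[z in wedge _ z]swK wsw => yz.
  rewrite -[z in wedge z]swK -[x in wedge _ x]swK wsw => zx.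
  exact: (P3 _ _ _ Px Pz Py zx yz xy).
move=> /(rightmost (l := map swap l)) [||_ /mapP[y yl ->] ymin].
- by move=> _ /mapP[x xl ->]; rewrite swK; apply: Pl.
- by rewrite -size_eq0 size_map size_eq0.
by exists y => // x xl; rewrite -wsw; apply/ymin/map_f.
Qed.

(* Gordan's theorem in the plane, with Caratheodory's bound. *)
Lemma half_plane (P : F * F -> Prop) (l : seq (F * F)) :
  half_planar P -> (forall x, x \in l -> P x) ->
  exists t, forall x, x \in l -> 0 < wedge t x.
Proof.
move=> hP Pl; have [->|l0] := eqVneq l [::]; first by exists 0.
have [y yl ymin] := rightmost hP Pl l0.
have [z zl zmax] := leftmost hP Pl l0; case: hP => P0 P2 _.
have := ymin z zl; rewrite le_eqVlt => /predU1P[/esym yz|yz].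
  (* The two extreme vectors are parallel, so the whole list lies on one ray, and the dot product
     with [y] is positive. *)
  exists (perp y) => x xl; rewrite wedge_perp.
  have yzp := P2 _ _ (Pl _ yl) (Pl _ zl) yz.
  apply: P2 (Pl _ yl) (Pl _ xl) _; apply/le_anti; rewrite (ymin _ xl) andbT.
  rewrite wedgeC oppr_le0 -(pmulr_rge0 _ (dot_gt0 (P0 _ (Pl _ zl)))).
  rewrite wedge_parallel; last by rewrite wedgeC yz oppr0.
  by rewrite dotC pmulr_rge0 // zmax.
(* Both [wedge y x] and [wedge x z] are nonnegative; if both vanished, [y] and [z] would be
   parallel. *)
exists (y - z) => x xl; rewrite wedgeBl [wedge z x]wedgeC opprK.
rewrite lt0r addr_ge0 ?ymin ?zmax // andbT paddr_eq0 ?ymin ?zmax //.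
apply/negP => /andP[/eqP yx /eqP xz]; move: yz.
have xp := dot_gt0 (P0 _ (Pl _ xl)).
rewrite -(pmulr_rgt0 _ xp).
have := wedge_parallel y xz; rewrite yx mulr0 => ->.
by rewrite ltxx.
Qed.

End HalfPlane.

(** * Vectors with integer coordinates *)

Section IntegerPlane.
Implicit Types x y t : int * int.

Lemma generic_perturbation t (l l' : seq (int * int)) :
  (forall x, x \in l -> 0 < wedge t x) -> (forall x, x \in l' -> x != 0) ->
  exists t', (forall x, x \in l -> 0 < wedge t' x) /\
             (forall x, x \in l' -> wedge t' x != 0).
Proof.
move=> tl; elim: l' => [|x l' IH] l'0; first by exists t.
have [y yl|t1 [tl' tl0]] := IH; first by apply: l'0; rewrite inE yl orbT.
have [tx|tx] := eqVneq (wedge t1 x) 0; last first.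
  by exists t1; split => // y; rewrite inE => /predU1P[->|/tl0].
(* The new vector is [M] times [t1] plus [perp x]. A nonzero integer [wedge t1 y] has absolute value
   at least 1, so after scaling by [M] it outweighs the perturbation and keeps its sign; at [x] the
   perturbation contributes [dot x x]. *)
pose M := 1 + \sum_(y <- l ++ l') `|wedge (perp x) y|.
have Mgt y : y \in l ++ l' -> `|wedge (perp x) y| < M.
  move=> yl; rewrite /M (big_rem y) //= addrCA ltrDl.
  by rewrite ltr_pwDl // sumr_ge0.
have M0 : 0 < M by rewrite ltr_pwDl // sumr_ge0.
have E y : wedge ((M * t1.1, M * t1.2) + perp x) y
    = M * wedge t1 y + wedge (perp x) y by rewrite /wedge /=; ring.
exists ((M * t1.1, M * t1.2) + perp x); split=> y yl; rewrite E.
  have := Mgt y; rewrite mem_cat yl => /(_ isT); have := tl' _ yl.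
  nia.
move: yl; rewrite inE => /predU1P[->|yl].
  by rewrite tx mulr0 add0r wedge_perp gt_eqF // dot_gt0 // l'0 ?mem_head.
have := Mgt y; rewrite mem_cat yl orbT => /(_ isT); have := tl0 _ yl.
nia.
Qed.

Lemma pair_mulrn x n : x *+ n = (x.1 * n%:Z, x.2 * n%:Z).
Proof. by elim: n => [|n IH]; rewrite ?mulr0 // mulrS IH; congr pair; rewrite /=; lia. Qed.

Lemma pair_mulrz x (n : int) : x *~ n = (x.1 * n, x.2 * n).
Proof.
case: n => n; first exact: pair_mulrn.
by rewrite NegzE mulrNz -pmulrn pair_mulrn !mulrN.
Qed.

(** The projection of [x] to the line of [y] with denominators cleared, so that both sides can act
    as lattice translations. *)
Lemma parallel_mulrz x y : wedge x y = 0 -> x *~ dot y y = y *~ dot x y.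
Proof.
rewrite !pair_mulrz /wedge /dot; case: x y => [a b] [c d] /= xy.
congr pair; apply/eqP; rewrite -subr_eq0; apply/eqP.
  transitivity (d * (a * d - b * c)); first by ring.
  by rewrite xy mulr0.
transitivity (- c * (a * d - b * c)); first by ring.
by rewrite xy mulr0.
Qed.

Lemma same_dir x y t : wedge x y = 0 -> 0 < wedge t x -> 0 < wedge t y -> 0 < dot x y.
Proof.
move=> xy tx ty; have yy : 0 < dot y y.
  by apply: dot_gt0; apply: (@wedge_neq0r _ t); rewrite gt_eqF.
have := wedge_parallel t (_ : wedge y x = 0); rewrite wedgeC xy oppr0 => /(_ erefl).
by rewrite dotC => E; rewrite -(pmulr_lgt0 _ ty) -E mulr_gt0.
Qed.

End IntegerPlane.

(* If a closed chain of vectors turned always to the left within a half plane,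
   the ratios [d n / h n] would decrease strictly along the cycle. *)
Lemma cyclic_negative (R : realFieldType) (h d : nat -> R) N :
  (forall n, 0 < d n * h n.+1 - h n * d n.+1) ->
  (forall n, h (n + N.+1)%N = h n) -> (forall n, d (n + N.+1)%N = d n) ->
  exists n, h n < 0.
Proof.
move=> hd hN dN; have [//|no] := boolp.pselect (exists n, h n < 0).
have h0 n : 0 <= h n by rewrite leNgt; apply/negP => hn; apply: no; exists n.
have hS n : 0 < h n.+1.
  rewrite lt0r h0 andbT; apply/eqP => hn; have := hd n; have := hd n.+1.
  rewrite hn mulr0 mul0r subr0 sub0r oppr_gt0 => d1h2.
  have d1 : 0 < d n.+1 by rewrite ltNge; apply/negP => d1; have := h0 n.+2; nra.
  by have := h0 n; nra.
have hp n : 0 < h n by case: n => [|//]; rewrite -hN add0n.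
have r n : d n.+1 / h n.+1 < d n / h n.
  rewrite ltr_pdivrMr // mulrAC ltr_pdivlMr //; have := hd n; lra.
have rk k : d k.+1 / h k.+1 < d 0%N / h 0%N.
  by elim: k => [|k IH]; [exact: r|exact: lt_trans (r _) IH].
by have := rk N; rewrite -[N.+1]add0n hN dN ltxx.
Qed.

Section Cycles.
Variables (R : realFieldType) (A : Type) (f : A -> A) (x : A -> R * R) (u : R * R).
Hypothesis f_orbit : forall a, exists n, iter n.+1 f a = a.
Hypothesis u_neq0 : u != 0.

Let dot_wedge (y z : R * R) :
  dot u y * wedge u z - wedge u y * dot u z = dot u u * wedge y z.
Proof. by rewrite /dot /wedge; ring. Qed.

(** A closed cycle of left turns winds around the origin. [cyclic_negative] is applied to the
    coordinates of the vectors along and across [u]; for right turns the coordinate along [u] is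
    negated. *)
Lemma left_cycle_negative : (forall a, 0 < wedge (x a) (x (f a))) ->
  forall a, exists n, wedge u (x (iter n f a)) < 0.
Proof.
move=> xf a; have [N Na] := f_orbit a.
apply: (@cyclic_negative _ _ (fun n => dot u (x (iter n f a))) N) => n.
- by rewrite dot_wedge mulr_gt0 ?dot_gt0.
- by rewrite iterD Na.
- by rewrite iterD Na.
Qed.

Lemma right_cycle_negative : (forall a, wedge (x a) (x (f a)) < 0) ->
  forall a, exists n, wedge u (x (iter n f a)) < 0.
Proof.
move=> xf a; have [N Na] := f_orbit a.
apply: (@cyclic_negative _ _ (fun n => - dot u (x (iter n f a))) N) => n.
- by rewrite mulNr mulrN -opprD dot_wedge oppr_gt0 pmulr_rlt0 ?dot_gt0.
- by rewrite iterD Na.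
- by rewrite iterD Na.
Qed.

End Cycles.

(** * Orbits and walks in a tiling *)

Section Tilings.
Variables (V A B W : Type) (T : tiling V A B W).

Lemma nextb_orbit a : exists n, iter n.+1 (nextb T) a = a.
Proof.
have [|n] := (blP T (nextb T a) a).1.
  by apply/esym/(blP T); exists 1%N.
by rewrite -iterSr; exists n.
Qed.

Lemma nextw_orbit a : exists n, iter n.+1 (nextw T) a = a.
Proof.
have [|n] := (whP T (nextw T a) a).1.
  by apply/esym/(whP T); exists 1%N.
by rewrite -iterSr; exists n.
Qed.

Lemma rot_orbit a : exists n, iter n.+1 (rot T) a = a.
Proof.
have [|n] := (tlP T (rot T a) a).1.
  by apply/esym/(tlP T); exists 1%N.
by rewrite -iterSr; exists n.
Qed.

Lemma bl_nextb a : bl T (nextb T a) = bl T a.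
Proof. by apply/esym/(blP T); exists 1%N. Qed.

Lemma wh_nextw a : wh T (nextw T a) = wh T a.
Proof. by apply/esym/(whP T); exists 1%N. Qed.

Lemma tl_rot a : tl T (rot T a) = tl T a.
Proof. by apply/esym/(tlP T); exists 1%N. Qed.

Lemma tl_nextw a : tl T (nextw T a) = hd T a.
Proof. by rewrite nextwE tl_rot. Qed.

End Tilings.

Lemma iter_fix (A : Type) (f : A -> A) a n k : iter n f a = a ->
  iter (k * n) f a = a.
Proof. by move=> fa; elim: k => // k IH; rewrite mulSn iterD IH. Qed.

Lemma orbit_inj (A : Type) (f : A -> A) :
  (forall a, exists n, iter n.+1 f a = a) -> injective f.
Proof.
move=> orb a a' ff; have [n na] := orb a; have [n' na'] := orb a'.
(* The product of the two periods is a common positive period of [a] and [a'], and the first step of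
   that iteration already identifies them. *)
rewrite -(iter_fix n'.+1 na) -(iter_fix n.+1 na') [(n.+1 * _)%N]mulnC.
by rewrite mulSn addSn !iterSr ff.
Qed.

Lemma orbit_surj (A : Type) (f : A -> A) :
  (forall a, exists n, iter n.+1 f a = a) -> forall a, exists c, f c = a.
Proof. by move=> orb a; have [n] := orb a; exists (iter n f a). Qed.

Section TilingInj.
Variables (V A B W : Type) (T : tiling V A B W).

Lemma nextb_inj : injective (nextb T).
Proof. exact/orbit_inj/nextb_orbit. Qed.

Lemma nextw_inj : injective (nextw T).
Proof. exact/orbit_inj/nextw_orbit. Qed.

Lemma nextb_surj a : exists c, nextb T c = a.
Proof. exact/orbit_surj/nextb_orbit. Qed.

Lemma nextw_surj a : exists c, nextw T c = a.
Proof. exact/orbit_surj/nextw_orbit. Qed.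

Lemma walk_cat i w1 w2 j :
  walk T i (w1 ++ w2) j <-> exists2 k, walk T i w1 k & walk T k w2 j.
Proof.
elim: w1 i => [|s w1 IH] i /=.
  by split=> [w2j|[k <-]] //; exists i.
split=> [[si /IH[k w1k w2j]]|[k [si w1k] w2j]]; first by exists k.
by split=> //; apply/IH; exists k.
Qed.

Lemma step_invK : involutive (@step_inv A).
Proof. by case=> b a; rewrite /step_inv /= negbK. Qed.

Lemma step_src_inv s : step_src T (step_inv s) = step_dst T s.
Proof. by case: s => [[]]. Qed.

Lemma step_dst_inv s : step_dst T (step_inv s) = step_src T s.
Proof. by case: s => [[]]. Qed.

Definition inv_walk (w : seq (bool * A)) := rev (map (@step_inv A) w).

Lemma inv_walkK : involutive inv_walk.
Proof.
move=> w; rewrite /inv_walk map_rev revK -map_comp -[RHS]map_id.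
by apply: eq_map => s; apply: step_invK.
Qed.

Lemma walk_inv i w j : walk T i w j -> walk T j (inv_walk w) i.
Proof.
elim: w i => [|s w IH] i /=; first by move=> ->.
move=> [si /IH wj]; rewrite /inv_walk /= rev_cons -cats1.
by apply/walk_cat; exists (step_dst T s); rewrite //= step_src_inv step_dst_inv.
Qed.

End TilingInj.

(** * Transport along walks *)
Section Transport.
Variables (V A B W : Type) (T : tiling V A B W) (X : Type).
Variables (act : bool * A -> X -> X) (I : V -> X -> Prop).

(** Used for two kinds of values: elements of an abelian group, which gives potentials, and vertices
    of another tiling, which gives lifts of walks. [I i x] says that [x] is admissible at [i]; the
    laws of the action are required only there. *)
Definition transport (w : seq (bool * A)) (x : X) : X :=
  foldl (fun x s => act s x) x w.

Lemma transport_cat w1 w2 x :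
  transport (w1 ++ w2) x = transport w2 (transport w1 x).
Proof. exact: foldl_cat. Qed.

Hypothesis actI : forall s x, I (step_src T s) x -> I (step_dst T s) (act s x).
Hypothesis actK : forall s x, I (step_src T s) x -> act (step_inv s) (act s x) = x.
Hypothesis actb : forall a n x, iter n (nextb T) a = a -> I (tl T a) x ->
  transport (forward (traject (nextb T) a n)) x = x.
Hypothesis actw : forall a n x, iter n (nextw T) a = a -> I (tl T a) x ->
  transport (forward (traject (nextw T) a n)) x = x.

Lemma transportI i w j x : walk T i w j -> I i x -> I j (transport w x).
Proof.
elim: w i x => [|s w IH] i x /=; first by move=> ->.
by move=> [<-] wj Ix; apply: IH wj _; apply: actI.
Qed.

Lemma homotopic_transport i j w w' x :
  homotopic T i j w w' -> I i x -> transport w x = transport w' x.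
Proof.
move=> H Ix; elim: H => {w w'} //.
- by move=> w1 w2 w3 _ -> _ ->.
- move=> w1 s w2 /walk_cat[k w1k [sk _]]; rewrite !transport_cat /=.
  by rewrite actK // sk; apply: transportI w1k Ix.
- move=> w1 a [//|n] w2 na /walk_cat[k w1k [ak _]]; rewrite !transport_cat.
  by rewrite actb // -[tl T a]/(step_src T (true, a)) ak; apply: transportI w1k Ix.
- move=> w1 a [//|n] w2 na /walk_cat[k w1k [ak _]]; rewrite !transport_cat.
  by rewrite actw // -[tl T a]/(step_src T (true, a)) ak; apply: transportI w1k Ix.
Qed.

Lemma transportK i w j x :
  walk T i w j -> I i x -> transport (inv_walk w) (transport w x) = x.
Proof.
elim: w i x => [//|s w IH] i x /= [<-] wj Ix.
rewrite /inv_walk /= rev_cons -cats1 transport_cat (IH _ _ wj); last exact: actI.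
exact: actK.
Qed.

(** The loop [w] followed by the inverse of [w'] is null-homotopic and so acts trivially. *)
Lemma transport_indep i w w' j x : simply_connected T ->
  walk T i w j -> walk T i w' j -> I i x -> transport w x = transport w' x.
Proof.
move=> sc wj w'j Ix.
have loop : walk T i (w ++ inv_walk w') i.
  by apply/walk_cat; exists j => //; apply: walk_inv.
have := homotopic_transport (sc _ _ loop) Ix; rewrite transport_cat /= => E.
rewrite -[in RHS]E -{1}[w'](inv_walkK) (transportK (walk_inv w'j)) //.
exact: transportI wj Ix.
Qed.

End Transport.

(** * Potentials *)
Section Potential.
Variables (V A B W : Type) (T : tiling V A B W) (M : zmodType) (k : A -> M).
Hypothesis Tconn : connected T.
Hypothesis Tsc : simply_connected T.

(** The potential at [v] is the signed sum of [k] along any walk from [v0]; it is well defined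
    because [k] sums to zero around every face. *)
Lemma closed_exact :
  (forall a n, iter n (nextb T) a = a ->
     \sum_(c <- traject (nextb T) a n) k c = 0) ->
  (forall a n, iter n (nextw T) a = a ->
     \sum_(c <- traject (nextw T) a n) k c = 0) ->
  forall v0 : V, exists g : V -> M, forall a, g (hd T a) - g (tl T a) = k a.
Proof.
move=> kb kw v0.
pose act (s : bool * A) (x : M) := if s.1 then x + k s.2 else x - k s.2.
have actF l x : transport act (forward l) x = x + \sum_(c <- l) k c.
  elim: l x => [|c l IH] x /=; first by rewrite big_nil addr0.
  by rewrite IH big_cons addrA.
have [w wP] := choice (Tconn v0).
exists (fun v => transport act (w v) 0) => a.
have -> : transport act (w (hd T a)) 0 = transport act (w (tl T a) ++ [:: (true, a)]) 0.
  apply: (transport_indep (T := T) (I := fun _ _ => True)) Tsc (wP _) _ _ => //.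
  - by move=> [[] c] x _; rewrite /act /= ?addrK ?subrK.
  - by move=> c n x cn _; rewrite actF kb // addr0.
  - by move=> c n x cn _; rewrite actF kw // addr0.
  - by apply/walk_cat; exists (tl T a).
by rewrite transport_cat /= addrAC subrr add0r.
Qed.

Lemma sum_traject (f : A -> A) (g : A -> M) a n :
  \sum_(c <- traject f a n) (g (f c) - g c) = g (iter n f a) - g a.
Proof.
elim: n a => [|n IH] a; first by rewrite big_nil subrr.
by rewrite /= big_cons IH -iterSr addrC addrA subrK.
Qed.

End Potential.

(** * Coverings *)
Section Coverings.
Variables (V A B W V' A' B' W' V0 A0 B0 W0 : Type).
Variables (T : tiling V A B W) (T' : tiling V' A' B' W') (T0 : tiling V0 A0 B0 W0).
Variables (f : A -> A0) (f' : A' -> A0).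
Hypotheses (cf : covering T T0 f) (cf' : covering T' T0 f').

Let fb a : f (nextb T a) = nextb T0 (f a). Proof. by case: cf => [[]]. Qed.
Let fr a : f (rot T a) = rot T0 (f a). Proof. by case: cf => [[]]. Qed.
Let fb' a : f' (nextb T' a) = nextb T0 (f' a). Proof. by case: cf' => [[]]. Qed.
Let fr' a : f' (rot T' a) = rot T0 (f' a). Proof. by case: cf' => [[]]. Qed.

Lemma iter_comm (C D : Type) (h : C -> D) g g' :
  (forall c, h (g c) = g' (h c)) -> forall n c, h (iter n g c) = iter n g' (h c).
Proof. by move=> hg; elim=> //= n IH c; rewrite hg IH. Qed.

(** Coverings are given on arrows only, so lying over the same vertex of the base is expressed
    through arrows with these tails. *)
Definition over (v : V) (v' : V') : Prop :=
  exists a a', [/\ tl T a = v, tl T' a' = v' & f a = f' a'].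

Lemma over_lift a v' : over (tl T a) v' -> exists2 a', tl T' a' = v' & f' a' = f a.
Proof.
move=> [c [c' [/(tlP T)[n <-] <- cc']]]; exists (iter n (rot T') c').
  by apply/esym/(tlP T'); exists n.
by rewrite (iter_comm fr) (iter_comm fr') cc'.
Qed.

Lemma step_lift s v' : over (step_src T s) v' ->
  exists a', [/\ step_src T' (s.1, a') = v', f' a' = f s.2 &
                 over (step_dst T s) (step_dst T' (s.1, a'))].
Proof.
case: s => [[] a] /=.
  move=> /over_lift[a' av' aa']; exists a'; split=> //.
  by exists (nextb T a), (nextb T' a'); rewrite fb fb' aa'.
move=> /over_lift[c' cv' ca]; have [a' a'c'] := nextb_surj T' c'.
have aa' : f' a' = f a.
  by apply: (@nextb_inj _ _ _ _ T0); rewrite -fb -fb' a'c'.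
by exists a'; split; rewrite // /step_src /hd /= ?a'c' //; exists a, a'.
Qed.

Lemma step_lift_uniq b a a' : step_src T' (b, a) = step_src T' (b, a') ->
  f' a = f' a' -> a = a'.
Proof.
case: cf' => _ _ inj _ _; case: b; first exact: inj.
by move=> E F; apply: (@nextb_inj _ _ _ _ T'); apply: inj; rewrite // !fb' F.
Qed.

Lemma step_srcK b a a' : f a = f' a' -> over (step_src T (b, a)) (step_src T' (b, a')).
Proof.
case: b => aa'; first by exists a, a'.
by exists (nextb T a), (nextb T' a'); rewrite fb fb' aa'.
Qed.

(** The lifting criterion: the tail of [h a] is the end of the lift, starting at [tl T' a1'], of a
    walk from [tl T a1] to [tl T a]. *)
Lemma covering_lift a1 a1' : connected T -> simply_connected T -> f a1 = f' a1' ->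
  exists h, [/\ tiling_map T T' h, forall a, f' (h a) = f a & h a1 = a1'].
Proof.
move=> conn sc aa1.
(* Steps act on vertices of [T'] by unique lifting. Where nothing can be lifted, the vertex stays
   put, a default value. *)
have /choice[act actP] : forall sv : (bool * A) * V', exists y,
    over (step_src T sv.1) sv.2 -> exists a',
    [/\ step_src T' (sv.1.1, a') = sv.2, f' a' = f sv.1.2 & y = step_dst T' (sv.1.1, a')].
  move=> [s v]; have [sv|nsv] := pselect (over (step_src T s) v); last first.
    by exists v.
  by have [a' [P1 P2 _]] := step_lift sv; exists (step_dst T' (s.1, a')); exists a'.
have actE s a' : f' a' = f s.2 -> act (s, step_src T' (s.1, a')) = step_dst T' (s.1, a').
  move=> E; have [|c [/= P1 P2 ->]] := actP (s, step_src T' (s.1, a')).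
    by case: s E => [b a] E; apply: step_srcK.
  by rewrite (step_lift_uniq P1 (etrans P2 (esym E))).
pose tr := transport (fun s v => act (s, v)).
have actI s v : over (step_src T s) v -> over (step_dst T s) (act (s, v)).
  by move=> /step_lift[a' [<- E O]]; rewrite actE.
have actK s v : over (step_src T s) v -> act (step_inv s, act (s, v)) = v.
  move=> /step_lift[a' [<- E O]]; rewrite (actE s) //.
  have := actE (step_inv s) a' E; rewrite -[(_, a')]/(step_inv (s.1, a')).
  by rewrite step_src_inv step_dst_inv.
have trb a' a n : f a = f' a' ->
   tr (forward (traject (nextb T) a n)) (tl T' a') = tl T' (iter n (nextb T') a').
  elim: n a a' => //= n IH a a' aa'.
  rewrite (actE (true, a) a') // [LHS]IH ?iterSr //=; first by rewrite -iterSr.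
  by rewrite fb fb' aa'.
have trw a' a n : f a = f' a' ->
   tr (forward (traject (nextw T) a n)) (tl T' a') = tl T' (iter n (nextw T') a').
  elim: n a a' => //= n IH a a' aa'.
  rewrite (actE (true, a) a') // -[step_dst _ _]/(hd T' a') -tl_nextw.
  by rewrite IH -?iterSr // !nextwE fr fr' fb fb' aa'.
have indep := transport_indep actI actK.
have [w wP] := choice (conn (tl T a1)).
have over1 : over (tl T a1) (tl T' a1') by exists a1, a1'.
have {}indep i u u' v : walk T i u v -> walk T i u' v -> forall x, over i x ->
    tr u x = tr u' x.
  move=> uv u'v x ix; apply: indep sc uv u'v ix.
  - move=> a n x0 an /over_lift[a' <- aa']; rewrite [LHS]trb //.
    (* Boundaries of faces lift to closed walks because [f'] is unramified at their centres. *)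
    suff -> : iter n (nextb T') a' = a' by [].
    case: cf' => _ _ _ inj _; apply: inj; first by apply/esym/(blP T'); exists n.
    by rewrite (iter_comm fb') aa' -(iter_comm fb) an.
  - move=> a n x0 an /over_lift[a' <- aa']; rewrite [LHS]trw //.
    suff -> : iter n (nextw T') a' = a' by [].
    case: cf' => _ _ _ _ inj; apply: inj; first by apply/esym/(whP T'); exists n.
    have fw c : f (nextw T c) = nextw T0 (f c) by rewrite !nextwE fr fb.
    have fw' c : f' (nextw T' c) = nextw T0 (f' c) by rewrite !nextwE fr' fb'.
    by rewrite (iter_comm fw') aa' -(iter_comm fw) an.
have /choice[h hP] : forall a, exists a', tl T' a' = tr (w (tl T a)) (tl T' a1') /\ f' a' = f a.
  move=> a; have [|a' <- E] := @over_lift a (tr (w (tl T a)) (tl T' a1')).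
    exact: transportI (wP _) over1.
  by exists a'.
exists h; have huniq a a' : tl T' a' = tr (w (tl T a)) (tl T' a1') -> f' a' = f a -> h a = a'.
  move=> E F; have [hE hF] := hP a; apply: (@step_lift_uniq true); last by rewrite hF.
  by rewrite /= /step_src /= hE.
split; first split=> a; last 1 first.
- by apply: huniq => //; rewrite -(@indep _ [::] _ _ _ (wP _)).
- have [hE hF] := hP a; apply: huniq; last by rewrite fb' fb hF.
  rewrite -(@indep _ (w (tl T a) ++ [:: (true, a)]) _ _ _ (wP _)) //.
    by rewrite /tr transport_cat -/tr -hE /= (actE (true, a) (h a)).
  by apply/walk_cat; exists (tl T a).
- have [hE hF] := hP a; apply: huniq; last by rewrite fr' fr hF.
  by rewrite tl_rot hE tl_rot.
by move=> a; case: (hP a).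
Qed.

End Coverings.

Section CoverIso.
Variables (V A B W V' A' B' W' V0 A0 B0 W0 : Type).
Variables (T : tiling V A B W) (T' : tiling V' A' B' W') (T0 : tiling V0 A0 B0 W0).
Variables (f : A -> A0) (f' : A' -> A0).
Hypotheses (cf : covering T T0 f) (cf' : covering T' T0 f').

(** Finite orbits make [P] stable also under the inverses of [nextb] and [rot], so it spreads along
    any walk. *)
Lemma arrow_connected (P : A -> Prop) a1 : connected T ->
  (forall a, P a -> P (nextb T a)) -> (forall a, P a -> P (rot T a)) ->
  P a1 -> forall a, P a.
Proof.
move=> conn Pb Pr P1.
have Pv v a c : tl T a = v -> tl T c = v -> P a -> P c.
  by move=> <- /esym/(tlP T)[n <-] Pa; elim: n => //= n; apply: Pr.
have Pb' a : P (nextb T a) -> P a.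
  by move=> Pa; have [n <-] := nextb_orbit T a; rewrite iterSr; elim: n => //= n; apply: Pb.
have Pw w i j : walk T i w j -> (forall a, tl T a = i -> P a) -> forall a, tl T a = j -> P a.
  elim: w i => [|[[] c] w IH] i /=; first by move=> ->.
    move=> [ci wj] Pi; apply: IH wj _ => a aE.
    by apply: (Pv _ (nextb T c)) aE (Pb _ (Pi _ ci)).
  move=> [ci wj] Pi; apply: IH wj _ => a aE.
  by apply: (Pv _ c) aE (Pb' _ (Pi _ ci)).
move=> a; have [w wa] := conn (tl T a1) (tl T a).
by apply: Pw wa _ _ erefl => c c1; apply: (Pv _ a1) c1 P1.
Qed.

Lemma tiling_map_uniq h g a1 : connected T -> tiling_map T T' h ->
  tiling_map T T' g -> h a1 = g a1 -> h =1 g.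
Proof.
move=> conn [hb hr] [gb gr]; apply: arrow_connected conn _ _ => a E.
  by rewrite hb gb E.
by rewrite hr gr E.
Qed.

End CoverIso.

(** Lifts in the two directions are mutually inverse, since their composites fix an arrow. With both
    coverings equal this yields deck transformations. *)
Lemma covering_iso (V A B W V' A' B' W' V0 A0 B0 W0 : Type)
  (T : tiling V A B W) (T' : tiling V' A' B' W') (T0 : tiling V0 A0 B0 W0)
  (f : A -> A0) (f' : A' -> A0) a a' :
  covering T T0 f -> covering T' T0 f' ->
  connected T -> simply_connected T -> connected T' -> simply_connected T' ->
  f a = f' a' ->
  exists h, [/\ tiling_map T T' h, bijective h, forall a, f' (h a) = f a & h a = a'].
Proof.
move=> cf cf' conn sc conn' sc' E.
have [h [hT hf ha]] := covering_lift cf cf' conn sc E.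
have [g [gT gf ga]] := covering_lift cf' cf conn' sc' (esym E).
exists h; split=> //; exists g.
  apply: (tiling_map_uniq (T := T) (T' := T) (g := id) (a1 := a)) => //.
    by case: gT hT => [gb gr] [hb hr]; split=> c; rewrite /= ?hb ?gb ?hr ?gr.
  by rewrite /= ha ga.
apply: (tiling_map_uniq (T := T') (T' := T') (g := id) (a1 := a')) => //.
  by case: gT hT => [gb gr] [hb hr]; split=> c; rewrite /= ?gb ?hb ?gr ?hr.
by rewrite /= ga ha.
Qed.

(** * Strips of rhombi *)

(* Edges are directed from [eL] on the left of their strip to [eR] on its right;
   [zeta] sends an edge to the opposite edge of the next rhombus of the strip.
   The lattice acts by [tr] and [te], and through the vectors [L w] on the plane;
   [clv] and [cle] are classes modulo this action. *)
Section Strips.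
Variables (R : realType) (Vx Ed : Type) (Cv Ce : finType).
Variables (eL eR : Ed -> Vx) (zeta : Ed -> Ed) (pos : Vx -> R * R).
Variables (tr : int * int -> Vx -> Vx) (te : int * int -> Ed -> Ed).
Variables (L : int * int -> R * R) (kappa : R) (clv : Vx -> Cv) (cle : Ed -> Ce).

Definition adj (x y : Vx) : Prop :=
  exists E, (eL E = x /\ eR E = y) \/ (eR E = x /\ eL E = y).

Fixpoint reach (n : nat) (x y : Vx) : Prop :=
  if n is m.+1 then exists2 z, adj x z & reach m z y else x = y.

(** The parameter [y] is the end of the path and the index its start; each step points strictly to
    the right of [u]. *)
Inductive desc (u : R * R) (y : Vx) : Vx -> Prop :=
| desc_refl : desc u y y
| desc_step x z : adj x z -> wedge u (pos z - pos x) < 0 -> desc u y z -> desc u y x.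

Definition vec (E : Ed) : R * R := pos (eR E) - pos (eL E).

Hypothesis reach_total : forall x y, exists n, reach n x y.
Hypothesis cochain_exact : forall c : Ed -> int, (forall E, c (zeta E) = c E) ->
  exists g : Vx -> int, forall E, g (eR E) - g (eL E) = c E.
Hypothesis zeta_inj : injective zeta.
Hypothesis vec_zeta : forall E, vec (zeta E) = vec E.
Hypothesis adjL : forall E, adj (eL E) (eL (zeta E)).
Hypothesis adjR : forall E, adj (eR E) (eR (zeta E)).
Hypothesis wedge_zeta : forall E, 0 < wedge (vec E) (pos (eL (zeta E)) - pos (eL E)).
Hypothesis descend : forall x (u : R * R), u != 0 -> exists y, adj x y /\ wedge u (pos y - pos x) < 0.
Hypothesis pos_inj : injective pos.
Hypothesis edge_inj : forall E E', eL E = eL E' -> eR E = eR E' -> E = E'.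
Hypothesis pos_tr : forall w x, pos (tr w x) = pos x + L w.
Hypothesis eL_te : forall w E, eL (te w E) = tr w (eL E).
Hypothesis eR_te : forall w E, eR (te w E) = tr w (eR E).
Hypothesis te_zeta : forall w E, te w (zeta E) = zeta (te w E).
Hypothesis LD : forall w w' : int * int, L (w + w') = L w + L w'.
Hypothesis wedge_L : forall w w', wedge (L w) (L w') = kappa * (wedge w w')%:~R.
Hypothesis kappa_gt0 : 0 < kappa.
Hypothesis clvP : forall x y, clv x = clv y -> exists w, y = tr w x.
Hypothesis cleP : forall E E', cle E = cle E' -> exists w, E' = te w E.
Hypothesis cle_te : forall w E, cle (te w E) = cle E.
Hypothesis cle_period : forall E, exists n, cle (iter n.+1 zeta E) = cle E.

Lemma adj_sym x y : adj x y -> adj y x.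
Proof. by case=> E [] [P1 P2]; exists E; [right|left]. Qed.

Lemma reach_cat m n x y z : reach m x y -> reach n y z -> reach (m + n) x z.
Proof.
by elim: m x => [x ->|m IH x /= [a xa ay] yz] //; exists a => //; apply: IH.
Qed.

Lemma reach_rcons n x y z : reach n x y -> adj y z -> reach n.+1 x z.
Proof. by move=> xy yz; rewrite -addn1; apply: reach_cat xy _; exists z. Qed.

Lemma reach_sym n x y : reach n x y -> reach n y x.
Proof.
elim: n x => [//|n IH] x [z xz zy].
exact: reach_rcons (IH _ zy) (adj_sym xz).
Qed.

Lemma reach_ind_all (P : Vx -> Prop) x : (forall y z, adj y z -> P y -> P z) ->
  P x -> forall y, P y.
Proof.
move=> Padj Px y; have [n] := reach_total x y.
by elim: n x Px => [x Px <-|n IH x Px [z xz zy]] //; apply: IH zy; apply: Padj xz Px.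
Qed.

Definition same_strip (E E' : Ed) : Prop :=
  (exists k, iter k zeta E = E') \/ (exists k, iter k zeta E' = E).

Lemma same_strip_refl E : same_strip E E.
Proof. by left; exists 0%N. Qed.

Lemma same_strip_sym E E' : same_strip E E' -> same_strip E' E.
Proof. by case=> ?; [right|left]. Qed.

Lemma same_strip_zeta E E' : same_strip E (zeta E') <-> same_strip E E'.
Proof.
split=> -[] [k].
- case: k => [/= ->|k]; first by right; exists 1%N.
  by rewrite iterS => /zeta_inj ?; left; exists k.
- by rewrite -iterSr => ?; right; exists k.+1.
- by move=> <-; left; exists k.+1.
- case: k => [/= <-|k]; first by left; exists 1%N.
  by rewrite iterSr => ?; right; exists k.
Qed.

Lemma same_strip_iter k E E' : same_strip E (iter k zeta E') <-> same_strip E E'.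
Proof.
by elim: k => [|k IH] //; rewrite iterS; apply: iff_trans (same_strip_zeta _ _) IH.
Qed.

Lemma same_strip_trans E E' E'' :
  same_strip E E' -> same_strip E' E'' -> same_strip E E''.
Proof.
move=> EE' [[k <-]|[k E'E]]; first by apply/same_strip_iter.
by apply/(same_strip_iter k); rewrite E'E.
Qed.

Lemma vec_iter k E : vec (iter k zeta E) = vec E.
Proof. by elim: k => //= k IH; rewrite vec_zeta. Qed.

Lemma vec_strip E E' : same_strip E E' -> vec E' = vec E.
Proof. by case=> -[k <-]; rewrite vec_iter. Qed.

Lemma wedge_zetaR E : 0 < wedge (vec E) (pos (eR (zeta E)) - pos (eR E)).
Proof.
suff -> : pos (eR (zeta E)) - pos (eR E) = pos (eL (zeta E)) - pos (eL E) by [].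
have := vec_zeta E; rewrite /vec => /eqP; rewrite subr_eq => /eqP ->.
by rewrite addrC !addrA addNr add0r addrC.
Qed.

Lemma adj_vec x y : adj x y -> exists E,
  ((eL E = x /\ eR E = y) /\ pos y - pos x = vec E) \/
  ((eR E = x /\ eL E = y) /\ pos y - pos x = - vec E).
Proof.
by case=> E [] [<- <-]; exists E; [left|right]; split => //; rewrite /vec opprB.
Qed.

(** ** The two sides of a strip *)
Definition is_side (E : Ed) (s : Vx -> bool) : Prop :=
  forall E', (same_strip E E' -> s (eL E') = false /\ s (eR E') = true) /\
             (~ same_strip E E' -> s (eL E') = s (eR E')).

(** The indicator of the strip is invariant under [zeta], hence has a potential [g]. Edges running
    along the strip are not parallel to [vec E], so they lie outside it, and [g] is constant on the
    left boundary and larger by one on the right boundary. *)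
Lemma is_side_exists E : exists s, is_side E s.
Proof.
pose c E' : int := if `[< same_strip E E' >] then 1 else 0.
have [g gP] : exists g : Vx -> int, forall E, g (eR E) - g (eL E) = c E.
  apply: cochain_exact => E'; rewrite /c.
  by congr (if _ then _ else _); apply/asboolP/asboolP => /same_strip_zeta.
have g_in E' : same_strip E E' -> g (eR E') = g (eL E') + 1.
  by move=> EE'; rewrite -(subrK (g (eL E')) (g (eR E'))) gP /c asboolT // addrC.
have g_out E' : ~ same_strip E E' -> g (eR E') = g (eL E').
  by move=> EE'; apply/eqP; rewrite -subr_eq0 gP /c asboolF.
have gz E' : same_strip E E' -> g (eL (zeta E')) = g (eL E').
  move=> EE'; have [F FP] := adj_vec (adjL E').
  have nF : ~ same_strip E F.
    move=> /vec_strip vF; have := wedge_zeta E'; rewrite (vec_strip EE').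
    by case: FP => -[_ ->]; rewrite vF ?wedgeNr wedgexx ?oppr0 ltxx.
  by case: FP => -[[<- <-] _]; rewrite g_out.
have gi k E' : same_strip E E' -> g (eL (iter k zeta E')) = g (eL E').
  move=> EE'; elim: k => //= k IH; rewrite gz //.
  by apply/same_strip_iter.
have g0 E' : same_strip E E' -> g (eL E') = g (eL E).
  by case=> -[k kE]; rewrite -kE gi //; [exact: same_strip_refl|right; exists k].
exists (fun x => g x == g (eL E) + 1) => E'; split=> EE'.
  rewrite (g_in _ EE') (g0 _ EE') eqxx; split=> //.
  by apply/eqP => /esym/eqP; rewrite -subr_eq0 addrAC subrr add0r.
by rewrite g_out.
Qed.

Lemma is_side_uniq E s s' : is_side E s -> is_side E s' -> s =1 s'.
Proof.
move=> sP s'P; apply: (@reach_ind_all (fun x => s x = s' x) (eL E)).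
  move=> y z [F FP]; have [sI sO] := sP F; have [s'I s'O] := s'P F.
  have [EF|EF] := pselect (same_strip E F).
    have [[a b] [c d]] := (sI EF, s'I EF).
    by case: FP => -[<- <-]; rewrite a b c d.
  by move: (sO EF) (s'O EF); case: FP => -[<- <-] a b; rewrite ?a ?b // -a -b.
have [[a _] [b _]] := ((sP E).1 (same_strip_refl E), (s'P E).1 (same_strip_refl E)).
by rewrite a b.
Qed.

Definition side : Ed -> Vx -> bool := projT1 (choice is_side_exists).

Lemma sideP E : is_side E (side E).
Proof. exact: projT2 (choice is_side_exists) E. Qed.

Lemma sideL E E' : same_strip E E' -> side E (eL E') = false.
Proof. by move=> /(sideP E E').1[]. Qed.

Lemma sideR E E' : same_strip E E' -> side E (eR E') = true.
Proof. by move=> /(sideP E E').1[]. Qed.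

Lemma side_strip E E' : same_strip E E' -> side E =1 side E'.
Proof.
move=> EE'; apply: is_side_uniq (sideP E) _ => F.
have [P1 P2] := sideP E' F; split=> EF.
  by apply: P1; apply: same_strip_trans EF; apply: same_strip_sym.
by apply: P2 => E'F; apply: EF; apply: same_strip_trans E'F.
Qed.

Lemma adj_side E x y : adj x y -> side E x != side E y ->
  exists2 F, same_strip E F &
    (side E x = false /\ (eL F = x /\ eR F = y)) \/
    (side E x = true /\ (eR F = x /\ eL F = y)).
Proof.
move=> [F FP] xy; have EF : same_strip E F.
  apply: contrapT => /(sideP E F).2 sF; move: xy.
  by case: FP => -[<- <-]; rewrite sF eqxx.
by exists F => //; case: FP => -[<- <-]; [left|right]; rewrite ?sideL ?sideR.
Qed.

(** ** Geodesics *)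
(** This measures progress along the strip: a step of either boundary gains exactly 1 and no step of
    the graph gains more, so both boundaries of a strip are geodesics. *)
Lemma strip_potential E : exists g : Vx -> int,
  forall x y, adj x y -> g y - g x = sgz (wedge (vec E) (pos y - pos x)).
Proof.
have [F|g gP] := cochain_exact (c := fun F => sgz (wedge (vec E) (vec F))).
  by rewrite vec_zeta.
exists g => x y /adj_vec[F [] [[<- <-] ->]]; rewrite ?gP // wedgeNr sgzN -gP.
by rewrite opprB.
Qed.

Lemma reach_iter E k (E' := iter k zeta E) :
  [/\ reach k (eL E) (eL E'), reach k (eR E) (eR E'),
      forall m, reach m (eL E) (eL E') -> (k <= m)%N &
      forall m, reach m (eR E) (eR E') -> (k <= m)%N].
Proof.
have [g gP] := strip_potential E.
have gm m x y : reach m x y -> `|g y - g x| <= m%:R.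
  elim: m x => [x ->|m IH x [z xz zy]]; first by rewrite subrr.
  rewrite -(subrK (g z) (g y)) -addrA (le_trans (ler_normD _ _)) // -addn1.
  by rewrite natrD lerD ?IH // gP // sgz_def; case: (_ == _); case: (_ < _).
have Lk : reach k (eL E) (eL E') /\ g (eL E') - g (eL E) = k%:R.
  rewrite /E'; elim: k {E'} => [|k [IH1 IH2]]; first by rewrite subrr.
  split.
    exact: reach_rcons IH1 (adjL _).
  rewrite -(subrK (g (eL (iter k zeta E))) (g _)) -addrA IH2 gP //.
  have := wedge_zeta (iter k zeta E); rewrite vec_iter => /gtr0_sgz ->.
  by rewrite -natr1 addrC.
have Rk : reach k (eR E) (eR E') /\ g (eR E') - g (eR E) = k%:R.
  rewrite /E'; elim: k {E' Lk} => [|k [IH1 IH2]]; first by rewrite subrr.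
  split.
    exact: reach_rcons IH1 (adjR _).
  rewrite -(subrK (g (eR (iter k zeta E))) (g _)) -addrA IH2 gP //.
  have := wedge_zetaR (iter k zeta E); rewrite vec_iter => /gtr0_sgz ->.
  by rewrite -natr1 addrC.
case: Lk => L1 L2; case: Rk => R1 R2; split=> // m /gm.
  by rewrite L2 ger0_norm ?ler0n // ler_nat.
by rewrite R2 ger0_norm ?ler0n // ler_nat.
Qed.

Lemma reach_strip E E' : same_strip E E' -> exists k,
  [/\ reach k (eL E) (eL E'), reach k (eR E) (eR E'),
      forall m, reach m (eL E) (eL E') -> (k <= m)%N &
      forall m, reach m (eR E) (eR E') -> (k <= m)%N].
Proof.
case=> -[k <-]; first by exists k; apply: reach_iter.
have [P1 P2 P3 P4] := reach_iter E' k; exists k; split.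
- exact: reach_sym.
- exact: reach_sym.
- by move=> m /reach_sym/P3.
- by move=> m /reach_sym/P4.
Qed.

Lemma reach_cross s n z y : reach n z y -> s z != s y :> bool ->
  exists z1 z2 m m', [/\ reach m z z1, adj z1 z2, reach m' z2 y,
    n = (m + m').+1 & s z1 = s z /\ s z2 != s z].
Proof.
elim: n z => [z zy|n IH z [x zx xy] szy]; first by rewrite (zy : z = y) eqxx.
have [/eqP sxz|sxz] := boolP (s x == s z); last first.
  by exists z, x, 0%N, n; split.
have [|z1 [z2 [m [m' [P1 P2 P3 -> P4]]]]] := IH x xy; first by rewrite sxz.
exists z1, z2, m.+1, m'; split => //; first by exists x.
by rewrite -sxz.
Qed.

(* If the strip of the first edge of a shortest path did not separate its ends,
   the path would recross this strip, and could be shortened by following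
   the strip instead. *)
Lemma geodesic_first n x z y F : (forall k, reach k x y -> (n < k)%N) ->
  adj x z -> reach n z y ->
  side F x != side F z -> side F x != side F y.
Proof.
move=> xy_min xz zy sxz; apply/negP => /eqP sxy.
have [|z1 [z2 [m [m' [zz1 z12 z2y nE [s1 s2]]]]]] := reach_cross zy (s := side F).
  by rewrite eq_sym -sxy.
have [E0 FE0 E0P] := adj_side xz sxz.
have [|E1 FE1 E1P] := adj_side (E := F) z12; first by rewrite s1 eq_sym.
have [k [kL kR kLm kRm]] : exists k, [/\ reach k (eL E0) (eL E1), reach k (eR E0) (eR E1),
      forall m, reach m (eL E0) (eL E1) -> (k <= m)%N &
      forall m, reach m (eR E0) (eR E1) -> (k <= m)%N].
  by apply/reach_strip/same_strip_trans/FE1/same_strip_sym.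
have [km xz2] : (k <= m)%N /\ reach k x z2.
  case: E0P => -[sx [xE zE]]; case: E1P => -[sz1 [z1E z2E]];
    move: sxz; rewrite sx -s1 sz1 // => _.
    by rewrite -xE -z2E; split => //; apply: kRm; rewrite zE z1E.
  by rewrite -xE -z2E; split => //; apply: kLm; rewrite zE z1E.
have := xy_min _ (reach_cat xz2 z2y); rewrite nE.
by apply/negP; rewrite -leqNgt ltnW // ltnS leq_add2r.
Qed.

(** By [geodesic_first] the first step of a shortest path crosses a strip separating [x] from [y].
    The strips separating the remaining ends already separate [x] from [y], in the same sense. *)
Lemma geodesic u x y :
  (forall E, side E x = false -> side E y = true -> wedge u (vec E) < 0) ->
  (forall E, side E x = true -> side E y = false -> 0 < wedge u (vec E)) ->
  desc u y x.
Proof.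
have : exists n, reach n x y /\ forall k, reach k x y -> (n <= k)%N.
  have [n0 n0P] := reach_total x y.
  have ex : exists n, `[< reach n x y >] by exists n0; apply/asboolP.
  case: (ex_minnP ex) => n /asboolP xy n_min; exists n; split=> // k xyk.
  exact/n_min/asboolP.
move=> [n [xy xy_min]]; elim: n x xy xy_min => [|n IH] x.
  by move=> xy *; rewrite (xy : x = y); apply: desc_refl.
move=> [z xz zy] xy_min Hf Hb.
have sep F : side F x != side F z -> side F x != side F y.
  exact: geodesic_first xy_min xz zy.
apply: (desc_step xz).
  have [E EP] := adj_vec xz; have := sep E; have EE := same_strip_refl E.
  case: EP => -[[xE zE] ->]; rewrite -xE -zE sideL // sideR //= => /(_ isT) sy.
    by apply: Hf; rewrite -?xE ?sideL //; case: (side E y) sy.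
  by rewrite wedgeNr oppr_lt0; apply: Hb; rewrite -?xE ?sideR //; case: (side E y) sy.
apply: IH => //.
- move=> k zy'; rewrite -ltnS; apply: xy_min; exists z => //.
- move=> E Ez Ey; apply: Hf => //; apply/negbTE/negP => Ex.
  by have := sep E; rewrite Ex Ez Ey => /(_ isT).
- move=> E Ez Ey; apply: Hb => //; apply: contraT => /negbTE Ex.
  by have := sep E; rewrite Ex Ez Ey => /(_ isT).
Qed.

(** ** Translations *)
Lemma tr_add w w' x : tr (w + w') x = tr w (tr w' x).
Proof. by apply: pos_inj; rewrite !pos_tr LD addrAC addrA. Qed.

Lemma L0 : L 0 = 0.
Proof. by apply: (addrI (L 0)); rewrite -LD !addr0. Qed.

Lemma tr0 x : tr 0 x = x.
Proof. by apply: pos_inj; rewrite pos_tr L0 addr0. Qed.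

Lemma te_add w w' E : te (w + w') E = te w (te w' E).
Proof. by apply: edge_inj; rewrite ?eL_te ?eR_te tr_add. Qed.

Lemma te0 E : te 0 E = E.
Proof. by apply: edge_inj; rewrite ?eL_te ?eR_te tr0. Qed.

Lemma te_iter w k E : te w (iter k zeta E) = iter k zeta (te w E).
Proof. by elim: k => //= k <-. Qed.

Lemma vec_te w E : vec (te w E) = vec E.
Proof. by rewrite /vec eL_te eR_te !pos_tr opprD addrACA subrr addr0. Qed.

Lemma same_strip_te w E E' : same_strip E E' -> same_strip (te w E) (te w E').
Proof. by case=> -[k <-]; [left|right]; exists k; rewrite te_iter. Qed.

Lemma adj_tr w x y : adj x y -> adj (tr w x) (tr w y).
Proof.
by case=> E [] [<- <-]; exists (te w E); rewrite eL_te eR_te; [left|right].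
Qed.

Lemma desc_tr u w x y : desc u y x -> desc u (tr w y) (tr w x).
Proof.
elim=> [|a b ab uab _ IH]; first exact: desc_refl.
apply: desc_step (adj_tr w ab) _ IH.
by rewrite !pos_tr opprD addrACA subrr addr0.
Qed.

Lemma desc_trans u x y z : desc u y x -> desc u z y -> desc u z x.
Proof.
by elim=> // a b ab uab _ IH yz; apply: desc_step ab uab (IH yz).
Qed.

Lemma side_te w E x : side (te w E) (tr w x) = side E x.
Proof.
apply: (is_side_uniq (s := fun x => side (te w E) (tr w x)) _ (sideP E)) => F.
rewrite -eL_te -eR_te; have [P1 P2] := sideP (te w E) (te w F).
split=> EF; first exact/P1/same_strip_te.
by apply: P2 => /(same_strip_te (- w)); rewrite -!te_add addNr !te0.
Qed.

Lemma side_trN w E x : side (te (- w) E) x = side E (tr w x).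
Proof. by rewrite -{1}[x]tr0 -(addNr w) tr_add side_te. Qed.

Lemma period_exists c : exists t, forall E, cle E = c ->
  exists n, iter n.+1 zeta E = te t E.
Proof.
have [[E0 E0c]|no] := pselect (exists E, cle E = c); last first.
  by exists 0 => E Ec; case: no; exists E.
have [n /esym/cleP[t tE]] := cle_period E0.
exists t => E; rewrite -E0c => /esym/cleP[v ->]; exists n.
by rewrite -te_iter tE -!te_add addrC.
Qed.

Definition period_of : Ce -> int * int := projT1 (choice period_exists).
Definition period (E : Ed) : int * int := period_of (cle E).

Lemma periodP E : exists n, iter n.+1 zeta E = te (period E) E.
Proof. exact: (projT2 (choice period_exists) _ _ erefl). Qed.

Lemma period_te w E : period (te w E) = period E.
Proof. by rewrite /period cle_te. Qed.

(** Edges of one strip in different classes may have been given different periods; each of these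
    translates the whole strip along itself. *)
Lemma period_strip E E' : same_strip E E' ->
  exists n, iter n.+1 zeta E' = te (period E) E'.
Proof.
have [n nE] := periodP E; case=> -[k kE]; exists n.
  by rewrite -kE te_iter -nE -!iterD addnC.
have inj_iter : injective (iter k zeta) by elim: k {kE} => // k IH x y /zeta_inj/IH.
by apply: inj_iter; rewrite -te_iter kE -nE -iterD addnC iterD kE.
Qed.

Lemma wedge_iter E k : 0 < wedge (vec E) (pos (eL (iter k.+1 zeta E)) - pos (eL E)).
Proof.
elim: k => [|k IH]; first exact: wedge_zeta.
rewrite -(subrK (pos (eL (iter k.+1 zeta E))) (pos _)) -addrA wedgeDr.
by rewrite addr_gt0 // -[vec E](vec_iter k.+1).
Qed.

Lemma period_gt0 E : 0 < wedge (vec E) (L (period E)).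
Proof.
have [n nE] := periodP E; have := wedge_iter E n.
by rewrite nE eL_te pos_tr [X in X - _]addrC addrK.
Qed.

Lemma period_neq0 E : period E != 0.
Proof. by apply: contraTneq (period_gt0 E) => ->; rewrite L0 wedge0r ltxx. Qed.

Lemma iter_te w n E m : iter n zeta E = te w E -> iter (m * n) zeta E = te (w *+ m) E.
Proof.
move=> nE; elim: m => [|m IH]; first by rewrite te0.
by rewrite mulSn iterD IH -te_iter nE -te_add mulrSr.
Qed.

Lemma same_strip_period E m : same_strip E (te (period E *+ m) E).
Proof. by have [n nE] := periodP E; left; exists (m * n.+1)%N; apply: iter_te. Qed.

Lemma side_periodn E m x : side E (tr (period E *+ m) x) = side E x.
Proof. by rewrite (side_strip (same_strip_period E m)) side_te. Qed.

Lemma side_period E (c : int) x : side E (tr (period E *~ c) x) = side E x.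
Proof.
case: c => m; first exact: side_periodn.
by rewrite NegzE mulrNz -(side_periodn E m.+1) -tr_add subrr tr0.
Qed.

Lemma L_mulrn w m : L (w *+ m) = L w *+ m.
Proof. by elim: m => [|m IH]; rewrite ?mulr0n ?L0 // !mulrS LD IH. Qed.

(** The distance from the line in the direction of the period is periodic along the strip. *)
Lemma strip_bounded E : exists B : R, forall E', same_strip E E' ->
  `|wedge (pos (eL E') - pos (eL E)) (L (period E))| <= B.
Proof.
have [n nE] := periodP E; set t := period E.
pose h k := `|wedge (pos (eL (iter k zeta E)) - pos (eL E)) (L t)|.
(* The sum over one period serves as a bound in place of the maximum. *)
exists (\sum_(k < n.+1) h k).
have hB k : h k <= \sum_(k < n.+1) h k.
  rewrite /h [in iter k](divn_eq k n.+1) addnC iterD (iter_te _ nE) -te_iter eL_te pos_tr.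
  rewrite addrAC wedgeDl L_mulrn wedgeMnl wedgexx mul0rn addr0.
  have kn : (k %% n.+1 < n.+1)%N by rewrite ltn_mod.
  by rewrite (bigD1 (Ordinal kn)) //= lerDl sumr_ge0.
move=> E' [[k <-]|[k kE]]; first exact: hB.
have [n' n'E] : exists n', iter n'.+1 zeta E' = te t E'.
  by apply: period_strip; right; exists k.
(* An edge [E'] behind [E] is moved ahead of it by [k] periods, which leaves the distance
   unchanged. *)
have kk : (k * n'.+1 = (k * n'.+1 - k) + k)%N by rewrite subnK // leq_pmulr.
have := hB (k * n'.+1 - k)%N; rewrite /h -{1}kE -iterD -kk (iter_te _ n'E) eL_te pos_tr.
by rewrite addrAC wedgeDl L_mulrn wedgeMnl wedgexx mul0rn addr0.
Qed.

(** The integer [wedge w (period E)] is nonzero, so [m] translations displace [E0] transversally by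
    at least [m * kappa], beyond the bounded width of the strip. *)
Lemma eventually_off E E0 w : wedge w (period E) != 0 ->
  exists m0, forall m, (m0 <= m)%N -> ~ same_strip E (te (w *+ m) E0).
Proof.
move=> wt; have [B BE] := strip_bounded E; set t := period E in wt *.
pose C := (B + `|wedge (pos (eL E0) - pos (eL E)) (L t)|) / kappa.
exists (Num.bound C) => m mC /BE.
rewrite eL_te pos_tr -/t addrAC wedgeDl L_mulrn wedgeMnl => H.
have {}H : `|wedge (L w) (L t) *+ m| <= C * kappa.
  rewrite /C mulfVK ?gt_eqF //; set a := wedge _ (L t) in H *.
  rewrite -[X in `|X|](addKr a) addrC (le_trans (ler_normB _ _)) //.
  by rewrite lerD2r // addrC.
have C0 : 0 <= C by rewrite -(pmulr_lge0 _ kappa_gt0) (le_trans _ H).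
have := archi_boundP C0; apply/negP; rewrite -leNgt.
rewrite -(ler_pM2r kappa_gt0); apply: le_trans H.
have -> : `|wedge (L w) (L t) *+ m| = m%:R * `|(wedge w t)%:~R| * kappa.
  by rewrite wedge_L normrMn normrM (gtr0_norm kappa_gt0) -mulr_natl; ring.
rewrite ler_pM2r //.
apply: (@le_trans _ _ m%:R); first by rewrite ler_nat.
rewrite ler_peMr ?ler0n //.
by rewrite -intr_norm ler1z; move: wt; rewrite -normr_gt0.
Qed.

(** Each of the finitely many edges of a path from [x] to [y] is eventually translated off the
    strip. *)
Lemma eventually_eq E x y w : wedge w (period E) != 0 ->
  exists m0, forall m, (m0 <= m)%N -> side E (tr (w *+ m) x) = side E (tr (w *+ m) y).
Proof.
move=> wt; move: y; apply: reach_ind_all => [y z [F FP] [m0 m0P]|]; last by exists 0%N.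
have [m1 m1P] := eventually_off F wt; exists (maxn m0 m1) => m.
rewrite geq_max => /andP[/m0P -> /m1P/(sideP E _).2].
by rewrite eL_te eR_te; case: FP => -[<- <-].
Qed.

(** Applied to [c = wedge w (period E)]: a positive value means that [w] points to the right of the
    strip, which is the side [true]. *)
Definition towards (b : bool) (c : int) : bool := if b then 0 < c else c < 0.

(** All edges of the strip have the vector [vec E], and by [period_gt0] crossing them descends only
    when it leads to the side [b]. *)
Lemma desc_side E b x y : desc (if b then L (period E) else - L (period E)) y x ->
  side E x = b -> side E y = b.
Proof.
elim=> // a c ac uac _ IH sa; apply: IH.
have [sac|sac] := eqVneq (side E a) (side E c); first by rewrite -sac.
have [F EF FP] := adj_side ac sac; have Fv := vec_strip EF.
have p := period_gt0 E; rewrite wedgeC oppr_gt0 in p.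
case: FP => -[sa' [aE cE]]; move: sa; rewrite sa' => b_eq; subst b.
  have : pos c - pos a = vec F by rewrite -aE -cE.
  by move=> ca; move: uac; rewrite ca Fv wedgeNl oppr_lt0 ltNge ltW.
have : pos c - pos a = - vec F by rewrite -aE -cE opprB.
by move=> ca; move: uac; rewrite ca Fv wedgeNr oppr_lt0 ltNge ltW.
Qed.

(* Descending steps repeat modulo translations, and never recross the strip. *)
Lemma side_ray E b : exists y w, towards b (wedge w (period E)) /\
  forall m, side E (tr (w *+ m) y) = b.
Proof.
pose u := if b then L (period E) else - L (period E).
have t0 : L (period E) != 0 := wedge_neq0r (lt0r_neq0 (period_gt0 E)).
have u0 : u != 0 by rewrite /u; case: (b); rewrite ?oppr_eq0.
have /choice[g gP] := fun x => descend x u0.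
pose x0 := if b then eR E else eL E.
have sx0 : side E x0 = b.
  by rewrite /x0; case: (b); rewrite ?sideL ?sideR //; apply: same_strip_refl.
pose y n := iter n g x0.
have yD k l : desc u (y (k + l)%N) (y k).
  elim: l => [|l IH]; first by rewrite addn0; apply: desc_refl.
  apply: desc_trans IH _; rewrite addnS; have [a d] := gP (y (k + l)%N).
  exact: desc_step a d (desc_refl _ _).
have yW k l : wedge u (pos (y (k + l.+1)%N) - pos (y k)) < 0.
  elim: l => [|l IH]; first by rewrite addn1; case: (gP (y k)).
  rewrite -(subrK (pos (y (k + l.+1)%N)) (pos (y (k + l.+2)%N))) -addrA wedgeDr.
  have [_] := gP (y (k + l.+1)%N); rewrite -[g _]/(y (k + l.+1).+1) -addnS.
  by move: IH; lra.
have [k [l /clvP[w yE]]] : exists k l, clv (y k) = clv (y (k + l.+1)%N).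
  pose f (i : 'I_#|Cv|.+1) := clv (y i).
  have /injectivePn[i [j ij fij]] : ~~ injectiveb f.
    apply/injectiveP => /leq_card; rewrite card_ord ltnn //.
  wlog lt_ij : i j ij fij / (i < j)%N.
    move=> wl; have [|ji] := ltnP i j; first exact: wl ij fij.
    by apply: (wl j i); rewrite 1?eq_sym // ltn_neqAle ji eq_sym val_eqE ij.
  by exists i, (j - i).-1; rewrite prednK ?subn_gt0 // subnKC // ltnW.
exists (y k), w; split.
  have := yW k l; rewrite yE pos_tr [X in X - _]addrC addrK /u /towards.
  case: (b); rewrite ?wedgeNl wedge_L.
    rewrite pmulr_rlt0 // ltrz0 [wedge w _]wedgeC; lia.
  rewrite oppr_lt0 pmulr_rgt0 // ltr0z [wedge w _]wedgeC; lia.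
move=> m; apply: (@desc_side E b (y k)); last first.
  by apply: (@desc_side E b x0); rewrite ?sx0 //; have := yD 0%N k.
elim: m => [|m IH]; first by rewrite tr0; apply: desc_refl.
by rewrite mulrS tr_add; apply: desc_trans (_ : desc u (tr w (y k)) _) (desc_tr w IH);
  rewrite -yE.
Qed.

Lemma eventually_side E b x w : towards b (wedge w (period E)) ->
  exists m0, forall m, (m0 <= m)%N -> side E (tr (w *+ m) x) = b.
Proof.
move=> wt; have [y [w0 [w0t w0P]]] := side_ray E b; set t := period E in wt w0t.
have ne c : towards b c -> c != 0 by rewrite /towards; case: (b) => ?; lia.
have [m0 m0P] := eventually_eq x (tr w x) (ne _ wt).
have [m1 m1P] := eventually_eq x y (ne _ w0t).
have step m : (m0 <= m)%N -> side E (tr (w *+ m) x) = side E (tr (w *+ m.+1) x).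
  by move=> /m0P ->; rewrite -tr_add mulrSr.
have const m : (m0 <= m)%N -> side E (tr (w *+ m) x) = side E (tr (w *+ m0) x).
  move=> /subnKC <-; elim: (m - m0)%N => [|k IH]; first by rewrite addn0.
  by rewrite addnS -step ?leq_addr.
pose A := `|wedge w0 t|%N; pose B := `|wedge w t|%N.
(* Cramer's rule in the lattice: up to a multiple of the period, which preserves the sides of the
   strip, a multiple of [w] is a multiple of the known ray [w0]. *)
have [c wE] : exists c : int, w *+ A = w0 *+ B + t *~ c.
  exists ((if b then -1 else 1) * wedge w w0); rewrite !pair_mulrn pair_mulrz /A /B.
  move: w0t wt; rewrite /towards; case: (b) => p q.
    by rewrite !gtz0_abs //; congr pair; rewrite /= /wedge; ring.
  by rewrite !ltz0_abs //; congr pair; rewrite /= /wedge; ring.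
have A0 : (0 < A)%N by rewrite absz_gt0 ne.
have B0 : (0 < B)%N by rewrite absz_gt0 ne.
(* This exponent is at least [m0], and it corresponds to [(m0 + m1) * B], at least [m1],
   translations by [w0]. *)
exists m0 => m /const ->; rewrite -(const ((m0 + m1) * A)%N); last first.
  by rewrite (leq_trans (leq_addr m1 m0)) // leq_pmulr.
rewrite mulnC mulrnA wE mulrnDl -mulrnA addrC tr_add.
rewrite -[t *~ c *+ _]/(t *~ c *~ (m0 + m1)%N%:Z) -mulrzA side_period m1P ?w0P //.
by rewrite (leq_trans (leq_addl m0 m1)) // leq_pmull.
Qed.

(** ** Crossings *)
(** A strip with an orientation: [o = false] reverses it, which negates vector and period and
    exchanges the sides. [oside o E x] puts [x] on the right of the oriented strip. *)
Definition ovec (o : bool) E := if o then vec E else - vec E.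
Definition operiod (o : bool) E := if o then period E else - period E.
Definition oside (o : bool) E x := side E x == o.

Lemma oside_neg o E x : oside (~~ o) E x = ~~ oside o E x.
Proof. by rewrite /oside; case: (side E x) o => -[]. Qed.

Lemma ovec_neg o E : ovec (~~ o) E = - ovec o E.
Proof. by case: o; rewrite /= ?opprK. Qed.

Lemma operiod_neg o E : operiod (~~ o) E = - operiod o E.
Proof. by case: o; rewrite /= ?opprK. Qed.

Lemma operiod_neq0 o E : operiod o E != 0.
Proof. by case: o; rewrite /= ?oppr_eq0 period_neq0. Qed.

Lemma ovec_operiod_gt0 o E : 0 < wedge (ovec o E) (L (operiod o E)).
Proof.
case: o => /=; first exact: period_gt0.
suff -> : L (- period E) = - L (period E).
  by rewrite wedgeNl wedgeNr opprK period_gt0.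
by apply/eqP; rewrite -addr_eq0 -LD addNr L0.
Qed.

Lemma eventually_oside o E x w : 0 < wedge w (operiod o E) ->
  exists m0, forall m, (m0 <= m)%N -> oside o E (tr (w *+ m) x).
Proof.
move=> wt; have [|m0 m0P] := @eventually_side E o x w.
  by move: wt; case: o => //=; rewrite wedgeNr oppr_gt0.
by exists m0 => m /m0P; rewrite /oside => ->.
Qed.

Lemma adj_oside_mono o E v x y : adj x y -> 0 < wedge v (pos y - pos x) ->
  0 < wedge v (ovec o E) -> oside o E x -> oside o E y.
Proof.
move=> xy vxy vE; rewrite /oside => /eqP sx.
have [sxy|sxy] := eqVneq (side E x) (side E y); first by rewrite -sxy sx.
have [F EF FP] := adj_side xy sxy; have Fv := vec_strip EF.
have p : pos y - pos x = ovec (~~ o) E.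
  move: FP; rewrite sx; case: (o) => -[] [] // _ [<- <-].
  - by rewrite /= -Fv /vec opprB.
  - by rewrite /= -Fv.
by move: vxy; rewrite p ovec_neg wedgeNr oppr_gt0 => /lt_trans/(_ vE); rewrite ltxx.
Qed.

Lemma iter_oside_mono o E E' k : 0 < wedge (vec E') (ovec o E) ->
  oside o E (eL E') -> oside o E (eL (iter k zeta E')).
Proof.
move=> vE s0; elim: k => //= k IH; apply: adj_oside_mono (adjL _) (wedge_zeta _) _ IH.
by rewrite vec_iter.
Qed.

(** Far along its period the strip of [E1] is on the right of the oriented strip of [E2], and far
    back on the left. Where it changes sides, its step is [ovec o E2], which is to the left of
    [vec E1] by [wedge_zeta]. *)
Lemma crossing E1 o E2 : 0 < wedge (period E1) (operiod o E2) ->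
  0 < wedge (vec E1) (ovec o E2) /\
  exists E, [/\ same_strip E1 E, oside o E2 (eL E) = false &
                oside o E2 (eL (zeta E)) = true].
Proof.
move=> t12; have [m mP] := eventually_oside (eL E1) t12.
have [|m' m'P] := @eventually_oside (~~ o) E2 (eL E1) (- period E1).
  by rewrite operiod_neg wedgeNl wedgeNr opprK.
have [n nE] := periodP E1.
(* The search for a crossing starts [m'] periods behind [E1], on the far side. *)
pose E0 := te (- period E1 *+ m') E1.
have E01 : iter (m' * n.+1) zeta E0 = E1.
  rewrite /E0 -te_iter (iter_te _ nE) -te_add mulNrn addNr.
  exact: te0.
have S0 k : same_strip E1 (iter k zeta E0).
  by apply/same_strip_iter; right; exists (m' * n.+1)%N.
have v0 k : vec (iter k zeta E0) = vec E1 by rewrite (vec_strip (S0 k)).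
have s0 : oside o E2 (eL E0) = false.
  by have := m'P m' (leqnn _); rewrite oside_neg eL_te => /negbTE.
have s1 : oside o E2 (eL (iter (m * n.+1 + m' * n.+1) zeta E0)) = true.
  by rewrite iterD E01 (iter_te _ nE) eL_te mP.
have [j [sj sj1]] : exists j, oside o E2 (eL (iter j zeta E0)) = false /\
    oside o E2 (eL (iter j.+1 zeta E0)) = true.
  elim: (m * n.+1 + m' * n.+1)%N s1 => [|k IH sk]; first by rewrite /= s0.
  case sk' : (oside o E2 (eL (iter k zeta E0))); first exact: IH.
  by exists k.
split; last by exists (iter j zeta E0).
rewrite -(v0 j); have := wedge_zeta (iter j zeta E0).
move: (adjL (iter j zeta E0)) sj sj1 => /=.
move: (eL _) (eL _) => y x xy sx sy.
have [|F EF FP] := adj_side (E := E2) xy.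
  by apply/eqP => sxy; move: sx sy; rewrite /oside sxy => ->.
have Fv := vec_strip EF; suff -> : pos y - pos x = ovec o E2 by [].
move: FP sx; rewrite /oside; case: (o) => -[] [-> [<- <-]] // _; rewrite /= -Fv //.
by rewrite /vec opprB.
Qed.

Lemma crossing_oriented o1 E1 o2 E2 : 0 < wedge (operiod o1 E1) (operiod o2 E2) ->
  0 < wedge (ovec o1 E1) (ovec o2 E2).
Proof.
case: o1 => /=; first by move=> /crossing[].
by rewrite !wedgeNl -!wedgeNr -operiod_neg -ovec_neg => /crossing[].
Qed.

(** A strip crosses another in one sense only. If the periods were parallel, a common multiple would
    bring the crossing strip back to the side from which it came. *)
Lemma crossing_wedge_period E1 E2 E : same_strip E1 E ->
  side E2 (eL E) != side E2 (eL (zeta E)) -> wedge (period E1) (period E2) != 0.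
Proof.
move=> E1E sE; apply/eqP => t12.
pose o := side E2 (eL (zeta E)).
have sx : oside o E2 (eL E) = false by apply/negbTE.
have sy : oside o E2 (eL (zeta E)) by apply/eqP.
have v12 : 0 < wedge (vec (zeta E)) (ovec o E2).
  have [F EF FP] := adj_side (adjL E) sE; have := wedge_zeta E.
  rewrite vec_zeta; suff -> : pos (eL (zeta E)) - pos (eL E) = ovec o E2 by [].
  move: sE; rewrite /o; case: FP => -[-> [<- <-]].
    by case: (side _ _) => // _; rewrite /= -(vec_strip EF).
  by case: (side _ _) => // _; rewrite /= -(vec_strip EF) /vec opprB.
have [n nE] := period_strip E1E.
pose A := `|dot (period E2) (period E2)|%N.
have A0 : (0 < A)%N by rewrite absz_gt0 gt_eqF // dot_gt0 // period_neq0.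
have tE : period E1 *+ A = period E2 *~ dot (period E1) (period E2).
  by rewrite /A pmulrn gtz0_abs ?dot_gt0 ?period_neq0 // parallel_mulrz.
have := iter_te A nE; case: A A0 tE => // A _ tE; rewrite mulSn addSn iterSr => E'.
have := iter_oside_mono (n + A * n.+1) v12 sy; rewrite E' eL_te tE /oside side_period.
by move: sx; rewrite /oside => ->.
Qed.

(** Strips with parallel periods do not cross, so each lies on one side of the other and one of the
    four combinations of sides is empty. *)
Lemma four_sides E1 E2 : ~ same_strip E1 E2 ->
  (forall b1 b2, exists x, side E1 x = b1 /\ side E2 x = b2) ->
  wedge (period E1) (period E2) != 0.
Proof.
move=> E12 comb; apply/eqP => t12.
have const F1 F2 : ~ same_strip F1 F2 -> wedge (period F1) (period F2) = 0 ->
    forall E, same_strip F1 E -> side F2 (eL E) = side F2 (eL F1) /\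
      side F2 (eR E) = side F2 (eL F1).
  move=> F12 tF E F1E.
  have out : ~ same_strip F2 E.
    by move=> F2E; apply: F12; apply: same_strip_trans F1E (same_strip_sym F2E).
  suff sE : side F2 (eL E) = side F2 (eL F1) by rewrite -(sideP F2 E).2.
  have cst k E' : same_strip F1 E' -> side F2 (eL (iter k zeta E')) = side F2 (eL E').
    move=> F1E'; elim: k => //= k <-; apply/esym/eqP; apply: contrapT => /negP sk.
    have := crossing_wedge_period (_ : same_strip F1 (iter k zeta E')) sk.
    by rewrite tF eqxx => H; apply/notF/H/same_strip_iter.
  case: F1E => -[k kE]; first by rewrite -kE cst //; apply: same_strip_refl.
  by rewrite -kE cst //; right; exists k.
have c1 := const _ _ E12 t12; have c2 := const E2 E1.
have {}c2 := c2 (fun h => E12 (same_strip_sym h)).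
have {}c2 : forall E, same_strip E2 E -> side E1 (eL E) = side E1 (eL E2) /\
    side E1 (eR E) = side E1 (eL E2) by apply: c2; rewrite wedgeC t12 oppr0.
(* The region of [x] is bounded by neither strip: an edge of one strip leading out of it would lie
   on the wrong side of the other. By connectedness it would be everything, but it misses [y]. *)
have [x [x1 x2]] := comb (~~ side E1 (eL E2)) (~~ side E2 (eL E1)).
have [y [y1 y2]] := comb (side E1 (eL E2)) (side E2 (eL E1)).
have : side E1 y = side E1 x /\ side E2 y = side E2 x.
  move: y {y1 y2}; apply: reach_ind_all => // y z yz [yx1 yx2].
  have [yz1|/(adj_side yz)[F E1F FP]] := eqVneq (side E1 y) (side E1 z); last first.
    have [a b] := c1 F E1F; case: FP => -[_ [yE zE]].
      by move: x2; rewrite -yx2 -yE a; case: (side _ _).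
    by move: x2; rewrite -yx2 -yE b; case: (side _ _).
  have [yz2|/(adj_side yz)[F E2F FP]] := eqVneq (side E2 y) (side E2 z); last first.
    have [a b] := c2 F E2F; case: FP => -[_ [yE zE]].
      by move: x1; rewrite -yx1 -yE a; case: (side _ _).
    by move: x1; rewrite -yx1 -yE b; case: (side _ _).
  by rewrite -yz1 -yz2.
by rewrite y1 x1; case=> + _; case: (side _ _).
Qed.

Lemma wedge_operiod o1 E1 o2 E2 :
  (wedge (operiod o1 E1) (operiod o2 E2) == 0) = (wedge (period E1) (period E2) == 0).
Proof. by case: o1 o2 => -[]; rewrite /= ?wedgeNl ?wedgeNr ?oppr_eq0. Qed.

(** If the periods were opposite, translating [i] far in the two directions perpendicular to [t1]
    would realise the two mixed combinations of sides; [i] and [j] realise the other two, against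
    [four_sides]. *)
Lemma separating_pair i j o1 E1 o2 E2 :
  ~~ oside o1 E1 i -> oside o1 E1 j -> ~~ oside o2 E2 i -> oside o2 E2 j ->
  wedge (operiod o1 E1) (operiod o2 E2) = 0 ->
  0 < dot (operiod o1 E1) (operiod o2 E2).
Proof.
move=> i1 j1 i2 j2 t12; set t1 := operiod o1 E1 in t12 *; set t2 := operiod o2 E2 in t12 *.
rewrite ltNge; apply/negP => dle.
have p1 : 0 < dot t1 t1 by rewrite dot_gt0 // operiod_neq0.
have p2 : 0 < dot t2 t2 by rewrite dot_gt0 // operiod_neq0.
have dlt : dot t1 t2 < 0.
  rewrite lt_neqAle dle andbT; apply/eqP => d0.
  have : dot t1 t1 * dot t2 t2 = dot t1 t2 ^+ 2 + wedge t1 t2 ^+ 2.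
    by rewrite /dot /wedge; ring.
  by rewrite d0 t12 expr0n addr0 => /eqP; rewrite mulf_eq0 !gt_eqF.
have [|m1 m1P] := @eventually_oside o1 E1 i (perp t1); first by rewrite wedge_perp.
have [|m2 m2P] := @eventually_oside (~~ o2) E2 i (perp t1).
  by rewrite operiod_neg wedgeNr oppr_gt0 wedge_perp.
have [|m3 m3P] := @eventually_oside (~~ o1) E1 i (- perp t1).
  by rewrite operiod_neg wedgeNr wedgeNl opprK wedge_perp.
have [|m4 m4P] := @eventually_oside o2 E2 i (- perp t1).
  by rewrite wedgeNl oppr_gt0 wedge_perp.
pose x := tr (perp t1 *+ (m1 + m2)) i; pose y := tr (- perp t1 *+ (m3 + m4)) i.
have {m1P}x1 : oside o1 E1 x by apply: m1P; rewrite leq_addr.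
have {m2P}x2 : ~~ oside o2 E2 x by rewrite -oside_neg m2P // leq_addl.
have {m3P}y1 : ~~ oside o1 E1 y by rewrite -oside_neg m3P // leq_addr.
have {m4P}y2 : oside o2 E2 y by apply: m4P; rewrite leq_addl.
have /eqP := t12; rewrite wedge_operiod; apply/negP/four_sides.
  have F : forall a b c d : bool, a != c -> a != d -> b == c -> b != d -> False.
    by do 4!case.
  by move=> /side_strip E12; move: i1 i2 x1 x2; rewrite /oside !E12; apply: F.
have sd o E v b : oside o E v = (b == o) -> side E v = b.
  by rewrite /oside; case: (side E v) b (o) => -[] [].
have nb (b : bool) : ~~ b -> b = false by case: b.
move=> b1 b2; case E1b : (b1 == o1); case E2b : (b2 == o2).
- by exists j; split; [apply: (sd o1)|apply: (sd o2)]; rewrite ?j1 ?j2 ?E1b ?E2b.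
- by exists x; split; [apply: (sd o1)|apply: (sd o2)]; rewrite ?x1 ?(nb _ x2) ?E1b ?E2b.
- by exists y; split; [apply: (sd o1)|apply: (sd o2)]; rewrite ?y2 ?(nb _ y1) ?E1b ?E2b.
- by exists i; split; [apply: (sd o1)|apply: (sd o2)]; rewrite ?(nb _ i1) ?(nb _ i2) ?E1b ?E2b.
Qed.

(** ** No separating triple spans the plane positively *)
(** A path leaving the common region of the sides [b] of three strips through the first of them
    crosses an edge of this kind. *)
Definition sees (b : bool) E1 o2 E2 o3 E3 : Prop :=
  exists E, [/\ same_strip E1 E, oside o2 E2 (eL E) = b & oside o3 E3 (eL E) = b].

Lemma seesC b E1 o2 E2 o3 E3 : sees b E1 o2 E2 o3 E3 -> sees b E1 o3 E3 o2 E2.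
Proof. by move=> [E [? ? ?]]; exists E. Qed.

(** Going along the first strip, the positive side of the second can only be entered and that of the
    third only be left. *)
Lemma not_sees_both E1 o2 E2 o3 E3 :
  0 < wedge (vec E1) (ovec o2 E2) -> wedge (vec E1) (ovec o3 E3) < 0 ->
  sees false E1 o2 E2 o3 E3 -> sees true E1 o2 E2 o3 E3 -> False.
Proof.
move=> v2 v3 [E [E1E f2 f3]] [E' [E1E' t2 t3]].
have vE := vec_strip E1E; have vE' := vec_strip E1E'.
case: (same_strip_trans (same_strip_sym E1E) E1E') => -[k kE].
  have := @iter_oside_mono (~~ o3) E3 E k; rewrite ovec_neg wedgeNr oppr_gt0 vE v3.
  by rewrite !oside_neg f3 kE t3 => /(_ isT isT).
have := @iter_oside_mono o2 E2 E' k; rewrite vE' v2 kE f2 t2.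
by move=> /(_ isT isT).
Qed.

Lemma not_sees_both_oriented o1 E1 o2 E2 o3 E3 :
  0 < wedge (ovec o1 E1) (ovec o2 E2) -> 0 < wedge (ovec o3 E3) (ovec o1 E1) ->
  sees false E1 o2 E2 o3 E3 -> sees true E1 o2 E2 o3 E3 -> False.
Proof.
rewrite [wedge (ovec o3 E3) _]wedgeC oppr_gt0.
case: o1 => /= v12 v13 s1 s2; first exact: not_sees_both v12 v13 s1 s2.
move: v12 v13; rewrite !wedgeNl oppr_gt0 oppr_lt0 => v12 v13.
exact: not_sees_both v13 v12 (seesC s1) (seesC s2).
Qed.

(** No edge of a rhombus where the first two strips cross belongs to the third strip, so all its
    corners are on one side [c] of that strip. Of two opposite edges of the rhombus, one lies on the
    side [c] of the strip crossed. *)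
Lemma crossing_sees o1 E1 o2 E2 o3 E3 :
  wedge (period E1) (period E2) != 0 ->
  wedge (vec E1) (vec E3) != 0 -> wedge (vec E2) (vec E3) != 0 ->
  exists b, sees b E1 o2 E2 o3 E3 /\ sees b E2 o1 E1 o3 E3.
Proof.
move=> t12 v13 v23.
have [o t12o] : exists o, 0 < wedge (period E1) (operiod o E2).
  move: t12; rewrite neq_lt => /orP[t12|t12]; last by exists true.
  by exists false; rewrite /= wedgeNr oppr_gt0.
have [v12 [E [E1E f2 t2]]] := crossing t12o.
have out F : same_strip E1 F \/ same_strip E2 F -> side E3 (eL F) = side E3 (eR F).
  move=> EF; apply: (sideP E3 F).2 => /vec_strip vF.
  case: EF => /vec_strip vF'; first by move: v13; rewrite -vF' -vF wedgexx eqxx.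
  by move: v23; rewrite -vF' -vF wedgexx eqxx.
have s2 : side E2 (eL E) != side E2 (eL (zeta E)).
  by move: f2 t2; rewrite /oside; case: (side _ _) (side _ _) (o) => -[] [].
have E2out F : same_strip E1 F -> side E2 (eL F) = side E2 (eR F).
  move=> E1F; apply: (sideP E2 F).2 => /vec_strip vF.
  move: v12; rewrite -(vec_strip E1F) vF; case: (o) => /=;
  by rewrite ?wedgeNr wedgexx ?oppr0 ltxx.
have E1z : same_strip E1 (zeta E) by apply/same_strip_zeta.
have [F E2F FP] := adj_side (adjL E) s2.
have [|F' E2F' F'P] := adj_side (E := E2) (adjR E); first by rewrite -!E2out.
pose c := oside o3 E3 (eL E); exists c.
have c3 : oside o3 E3 (eL F) = c /\ oside o3 E3 (eL F') = c /\
    oside o3 E3 (eL (zeta E)) = c.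
  have oF := out F (or_intror E2F); have oF' := out F' (or_intror E2F').
  have oE := out E (or_introl E1E); have oE' := out (zeta E) (or_introl E1z).
  rewrite /c /oside; case: FP F'P => -[_ [a b]] [] [_ [a' b']];
    by move: oF oF' oE oE'; rewrite ?a ?b ?a' ?b' => *; split; [|split]; congruence.
have E1n G : wedge (vec E1) (vec E2) != 0 -> same_strip E2 G ->
    side E1 (eL G) = side E1 (eR G).
  move=> v12' E2G; apply: (sideP E1 G).2 => /vec_strip vG.
  by move: v12'; rewrite -vG (vec_strip E2G) wedgexx eqxx.
have v12' : wedge (vec E1) (vec E2) != 0.
  by move: v12; case: (o) => /=; rewrite ?wedgeNr ?oppr_gt0 => ?; rewrite neq_lt; apply/orP; auto.
split.
  have [e|e] := eqVneq (oside o2 E2 (eL E)) c; first by exists E.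
  exists (zeta E); split => //; last by case: c3 => _ [].
  by move: s2 e; rewrite /oside; case: (c) (side _ _) (side _ _) (o2) => -[] [] [].
have sF : side E1 (eL F) = false.
  case: FP => -[_ [a b]]; first by rewrite a sideL.
  by rewrite E1n // a sideL.
have sF' : side E1 (eL F') = true.
  case: F'P => -[_ [a b]]; first by rewrite a sideR.
  by rewrite E1n // a sideR.
case: c3 => cF [cF' _]; have [e|e] := eqVneq (oside o1 E1 (eL F)) c; first by exists F.
by exists F'; split=> //; move: e; rewrite /oside sF sF'; case: (o1) (c) => -[].
Qed.

(** Each strip sees at most one value and crossing strips see a common one, so all three see the
    same. But a path between [i] and [j] leaves the region where all sides are [false] and, read
    backwards, the one where all are [true], so both values are seen. *)
Lemma separating_triple i j o1 E1 o2 E2 o3 E3 :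
  ~~ oside o1 E1 i -> oside o1 E1 j -> ~~ oside o2 E2 i -> oside o2 E2 j ->
  ~~ oside o3 E3 i -> oside o3 E3 j ->
  0 < wedge (operiod o1 E1) (operiod o2 E2) ->
  0 < wedge (operiod o2 E2) (operiod o3 E3) ->
  0 < wedge (operiod o3 E3) (operiod o1 E1) -> False.
Proof.
move=> i1 j1 i2 j2 i3 j3 t12 t23 t31.
have v12 := crossing_oriented t12; have v23 := crossing_oriented t23.
have v31 := crossing_oriented t31.
have n1 := not_sees_both_oriented v12 v31.
have n2 := not_sees_both_oriented v23 v12.
have n3 := not_sees_both_oriented v31 v23.
have vn o E o' E' : 0 < wedge (ovec o E) (ovec o' E') ->
    wedge (vec E) (vec E') != 0 /\ wedge (vec E') (vec E) != 0.
  rewrite [wedge (vec E') _]wedgeC oppr_eq0.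
  by case: o o' => -[] /=; rewrite ?wedgeNl ?wedgeNr ?opprK ?oppr_gt0 => ?;
    rewrite neq_lt; split; apply/orP; auto.
have tn o E o' E' : 0 < wedge (operiod o E) (operiod o' E') ->
    wedge (period E) (period E') != 0.
  by move=> t; rewrite -(wedge_operiod o E o' E') gt_eqF.
have [v12n v21n] := vn _ _ _ _ v12; have [v23n v32n] := vn _ _ _ _ v23.
have [v31n v13n] := vn _ _ _ _ v31.
have [b12 [s12 s21]] := crossing_sees o1 o2 o3 (tn _ _ _ _ t12) v13n v23n.
have [b23 [s23 s32]] := crossing_sees o2 o3 o1 (tn _ _ _ _ t23) v21n v31n.
have [b31 [s31 s13]] := crossing_sees o3 o1 o2 (tn _ _ _ _ t31) v32n v12n.
have leave b x y : oside o1 E1 x = b -> oside o2 E2 x = b -> oside o3 E3 x = b ->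
    ~~ [&& oside o1 E1 y == b, oside o2 E2 y == b & oside o3 E3 y == b] ->
    [\/ sees b E1 o2 E2 o3 E3, sees b E2 o3 E3 o1 E1 | sees b E3 o1 E1 o2 E2].
  move=> x1 x2 x3 yn; apply: contrapT => no.
  have out E E' F : wedge (vec E) (vec E') != 0 -> same_strip E F ->
      side E' (eL F) = side E' (eR F).
    move=> vEE' EF; apply: (sideP E' F).2 => /vec_strip vF.
    by move: vEE'; rewrite -vF (vec_strip EF) wedgexx eqxx.
  suff : [/\ oside o1 E1 y = b, oside o2 E2 y = b & oside o3 E3 y = b].
    by move=> [y1 y2 y3]; move: yn; rewrite y1 y2 y3 !eqxx.
  move: y {yn}; apply: (@reach_ind_all (fun y =>
    [/\ oside o1 E1 y = b, oside o2 E2 y = b & oside o3 E3 y = b]) x) => //.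
  move=> y z yz [y1 y2 y3].
  have keep E E' E'' o' o'' : wedge (vec E) (vec E') != 0 -> wedge (vec E) (vec E'') != 0 ->
      oside o' E' y = b -> oside o'' E'' y = b -> ~ sees b E o' E' o'' E'' ->
      side E y = side E z.
    move=> vE' vE'' y' y'' nos; apply/eqP; apply: contrapT => /negP/(adj_side yz)[F EF FP].
    apply: nos; exists F; split=> //; rewrite /oside.
      by rewrite -y' /oside; case: FP => -[_ [<- _]] //; rewrite (out E).
    by rewrite -y'' /oside; case: FP => -[_ [<- _]] //; rewrite (out E).
  rewrite /oside -(keep E1 E2 E3 o2 o3) -?(keep E2 E3 E1 o3 o1) -?(keep E3 E1 E2 o1 o2) //.
  - by move=> ?; apply: no; constructor 3.
  - by move=> ?; apply: no; constructor 2.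
  - by move=> ?; apply: no; constructor 1.
have nb (b : bool) : ~~ b -> b = false by case: b.
have sf := leave false i j (nb _ i1) (nb _ i2) (nb _ i3).
have st := leave true j i j1 j2 j3.
rewrite j1 in sf; rewrite (nb _ i1) in st.
have {}sf := sf isT; have {}st := st isT.
move: s21 s32 s13 => /seesC s21 /seesC s32 /seesC s13.
case: b12 s12 s21 => s12 s21; case: b23 s23 s32 => s23 s32; case: b31 s31 s13 => s31 s13;
  case: sf => sf; case: st => st; by [apply: n1 | apply: n2 | apply: n3].
Qed.

(** ** The two directions *)
(** A strip and its translate have equal periods, so by [four_sides] they are nested. Nesting in the
    wrong order would contradict that translates by large multiples of [T] end up on the right. *)
Lemma oside_tr_mono o E T x : 0 < wedge T (operiod o E) ->
  oside o E x -> oside o E (tr T x).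
Proof.
move=> TE x1; apply: contraT => x2; pose E2 := te (- T) E.
have E2P y : oside o E2 y = oside o E (tr T y) by rewrite /oside side_trN.
have [m mP] := eventually_oside x TE.
have [|m' m'P] := @eventually_oside (~~ o) E x (- T).
  by rewrite operiod_neg wedgeNl wedgeNr opprK.
pose y := tr (T *+ m) x; pose z := tr (- T *+ m'.+1) x.
have y1 : oside o E y by apply: mP.
have y2 : oside o E2 y by rewrite E2P -tr_add -mulrS mP.
have z1 : ~~ oside o E z by rewrite -oside_neg m'P.
have z2 : ~~ oside o E2 z.
  by rewrite E2P -tr_add mulrS addrA subrr add0r -oside_neg m'P.
have nE : ~ same_strip E E2.
  by move=> /side_strip EE2; move: x1 x2; rewrite -E2P /oside EE2 => ->.
(* The points [y], [x], [z] realise three of the combinations of sides of [E] and [E2]; a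
   counterexample [v] would be the fourth. *)
have mono v : oside o E (tr T v) -> oside o E v.
  move=> v2; apply: contraT => v1.
  have : wedge (period E) (period E2) != 0; last by rewrite /E2 period_te wedgexx eqxx.
  have sd F t b : oside o F t = (b == o) -> side F t = b.
    by rewrite /oside; case: (side F t) b (o) => -[] [].
  have nb (b : bool) : ~~ b -> b = false by case: b.
  apply: four_sides nE _ => b1 b2; case e1 : (b1 == o); case e2 : (b2 == o).
  - by exists y; split; apply: sd; rewrite ?y1 ?y2 ?e1 ?e2.
  - by exists x; split; apply: sd; rewrite ?x1 ?E2P ?(nb _ x2) ?e1 ?e2.
  - by exists v; split; apply: sd; rewrite ?E2P ?v2 ?(nb _ v1) ?e1 ?e2.
  - by exists z; split; apply: sd; rewrite ?(nb _ z1) ?(nb _ z2) ?e1 ?e2.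
have {}mono k v : oside o E (tr (T *+ k) v) -> oside o E v.
  by elim: k => [|k IH]; rewrite ?tr0 // mulrS tr_add => /mono.
by have [k kP] := eventually_oside z TE; move: z1; rewrite (mono k) // kP.
Qed.

Lemma oside_trn_mono o E T m x : 0 < wedge T (operiod o E) ->
  oside o E x -> oside o E (tr (T *+ m) x).
Proof.
move=> TE x1; elim: m => [|m IH]; first by rewrite tr0.
by rewrite mulrS tr_add oside_tr_mono.
Qed.

Lemma operiod_orient T E : wedge T (period E) != 0 ->
  exists o, 0 < wedge T (operiod o E).
Proof.
rewrite neq_lt => /orP[TE|TE]; last by exists true.
by exists false; rewrite /= wedgeNr oppr_gt0.
Qed.

(** One threshold serves all strips, since those separating [x] from [y] pass through edges of a
    fixed path between them. *)
Lemma eventually_separated T x y z : (forall E, wedge T (period E) != 0) ->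
  exists m0, forall m, (m0 <= m)%N -> forall o E, 0 < wedge T (operiod o E) ->
    side E x != side E y -> oside o E (tr (T *+ m) z).
Proof.
move=> T0; move: y; apply: (@reach_ind_all _ x) => [y y' [F FP] [m0 m0P]|].
  have [o oF] := operiod_orient (T0 F); have [m1 m1P] := eventually_oside z oF.
  exists (maxn m0 m1) => m; rewrite geq_max => /andP[mm0 mm1] o' E oE sxy'.
  have [sxy|sxy] := eqVneq (side E x) (side E y); last exact: m0P.
  have EF : same_strip E F.
    apply: contrapT => /(sideP E F).2 sF; move: sxy'; rewrite sxy.
    by case: FP => -[<- <-]; rewrite sF eqxx.
  have sFm := m1P m mm1; have [eo|eo] := eqVneq o o'.
    by rewrite -eo /oside (side_strip EF).
  have [m2 m2P] := eventually_oside z oE.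
  have /m2P := leq_maxl m2 m1; have := m1P _ (leq_maxr m2 m1).
  by rewrite /oside (side_strip EF) => /eqP ->; rewrite (negbTE eo).
by exists 0%N => m _ o E _; rewrite eqxx.
Qed.

Lemma separating_direction i j : exists T,
  (forall E, wedge T (period E) != 0) /\
  forall o E, ~~ oside o E i -> oside o E j -> 0 < wedge T (operiod o E).
Proof.
pose P x := exists o E, [/\ x = operiod o E, ~~ oside o E i & oside o E j].
have hP : half_planar P.
  split=> [x [o [E [-> _ _]]]|x y [o [E [-> i1 j1]]] [o' [E' [-> i2 j2]]]|].
  - exact: operiod_neq0.
  - exact: separating_pair i1 j1 i2 j2.
  move=> x y z [o [E [-> i1 j1]]] [o' [E' [-> i2 j2]]] [o'' [E'' [-> i3 j3]]].
  exact: separating_triple i1 j1 i2 j2 i3 j3.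
pose sep (oc : bool * Ce) := `[< exists E, [/\ cle E = oc.2, ~~ oside oc.1 E i & oside oc.1 E j] >].
(* Periods depend only on classes, so a finite list covers all the separating strips. *)
pose l := [seq (if oc.1 then period_of oc.2 else - period_of oc.2) | oc <- enum {: bool * Ce} & sep oc].
have [x|T0 T0P] := half_plane (l := l) hP.
  move=> /mapP[[o c]]; rewrite mem_filter => /andP[/asboolP[E [/= Ec i1 j1]] _] ->.
  by exists o, E; split; rewrite // /operiod /period Ec.
pose l' := [seq period_of c | c <- enum Ce & `[< exists E, cle E = c >]].
have [x|T [TP T0']] := generic_perturbation (l' := l') T0P.
  by move=> /mapP[c]; rewrite mem_filter => /andP[/asboolP[E <-] _] ->; apply: period_neq0.
exists T; split=> [E|o E i1 j1].
  apply: T0'; apply: map_f; rewrite mem_filter mem_enum andbT.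
  by apply/asboolP; exists E.
apply: TP; apply: (map_f (fun oc : bool * Ce => if oc.1 then period_of oc.2 else - period_of oc.2)
  (x := (o, cle E))).
by rewrite mem_filter mem_enum andbT; apply/asboolP; exists E.
Qed.

Lemma descending_direction T : (forall E, wedge T (period E) != 0) ->
  exists u, forall o E, 0 < wedge T (operiod o E) -> wedge u (ovec o E) < 0.
Proof.
move=> T0; pose P x := exists o E, x = ovec o E /\ 0 < wedge T (operiod o E).
have /choice[vec_of vec_ofP] : forall c, exists v, forall E, cle E = c -> vec E = v.
  move=> c; have [[E0 E0c]|no] := pselect (exists E, cle E = c); last first.
    by exists 0 => E Ec; case: no; exists E.
  by exists (vec E0) => E; rewrite -E0c => /esym/cleP[w ->]; rewrite vec_te.
have Lz t n : L (t *~ n) = L t *~ n.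
  case: n => n; first exact: L_mulrn.
  by rewrite NegzE !mulrNz -!pmulrn -L_mulrn; apply/eqP; rewrite -addr_eq0 -LD addNr L0.
have wz v (w : R * R) n : wedge v (w *~ n) = wedge v w *~ n.
  by case: n => n; [exact: wedgeMnr|rewrite NegzE !mulrNz wedgeNr -!pmulrn wedgeMnr].
have scale t1 t2 v : wedge t1 t2 = 0 ->
    wedge v (L t1) *~ dot t2 t2 = wedge v (L t2) *~ dot t1 t2.
  by move=> t12; rewrite -!wz -!Lz parallel_mulrz.
have dir t1 t2 v : wedge t1 t2 = 0 -> t2 != 0 -> 0 < dot t1 t2 ->
    (0 < wedge v (L t1)) = (0 < wedge v (L t2)).
  move=> t12 t2n d12; have := scale _ _ v t12.
  by move=> E; rewrite -(pmulrz_lgt0 _ (dot_gt0 t2n)) E pmulrz_lgt0.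
have le0 o E o' E' : 0 < wedge (ovec o' E') (ovec o E) ->
    wedge (operiod o E) (operiod o' E') <= 0.
  move=> v; rewrite leNgt; apply/negP => /crossing_oriented; rewrite wedgeC oppr_gt0.
  by rewrite ltNge ltW.
have hP : half_planar P.
  split=> [x [o [E [-> _]]]|x y [o [E [-> TE]]] [o' [E' [-> TE']]] xy|].
  - exact: wedge_neq0l (lt0r_neq0 (ovec_operiod_gt0 o E)).
  - have t0 : wedge (operiod o E) (operiod o' E') = 0.
      apply/eqP; apply: contraT; rewrite neq_lt => /orP[|/crossing_oriented].
        by rewrite wedgeC oppr_lt0 => /crossing_oriented; rewrite wedgeC xy oppr0 ltxx.
      by rewrite xy ltxx.
    have d0 := same_dir t0 TE TE'.
    have p1 := ovec_operiod_gt0 o E; have p2 := ovec_operiod_gt0 o' E'.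
    rewrite (dir _ _ _ t0) ?operiod_neq0 // in p1.
    set vx := ovec o E in xy p1 *; set vy := ovec o' E' in xy p2 *.
    have y0 : 0 < dot vy vy by rewrite dot_gt0 // (wedge_neq0l (lt0r_neq0 p2)).
    have := wedge_parallel (L (operiod o' E')) (_ : wedge vy vx = 0).
    rewrite wedgeC xy oppr0 => /(_ erefl); rewrite dotC => e.
    rewrite -(nmulr_llt0 _ (_ : wedge (L (operiod o' E')) vy < 0)); last first.
      by rewrite wedgeC oppr_lt0.
    by rewrite -e pmulr_rlt0 // wedgeC oppr_lt0.
  move=> x y z [o [E [-> TE]]] [o' [E' [-> TE']]] [o'' [E'' [-> TE'']]] xy yz zx.
  (* If three vectors wound around the origin, the three periods would have nonnegative cyclic
     wedges. All of them pair positively with [T], so Cramer's rule makes these wedges zero. *)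
  have := cramer (operiod o E) (operiod o' E') (operiod o'' E'') T.
  have := le0 _ _ _ _ xy; have := le0 _ _ _ _ yz; have := le0 _ _ _ _ zx.
  rewrite ![wedge (operiod o' E') (operiod o E)]wedgeC.
  rewrite [wedge (operiod o'' E'') (operiod o' E')]wedgeC.
  rewrite [wedge (operiod o E) (operiod o'' E'')]wedgeC !oppr_le0 => h1 h2 h3 h.
  have nn (a b : int) : 0 <= a -> 0 < b -> 0 <= a * b by move=> *; rewrite mulr_ge0 // ltW.
  have := nn _ _ h1 TE'; have := nn _ _ h2 TE; have := nn _ _ h3 TE'' => k3 k2 k1.
  have z0 (a b : int) : a * b = 0 -> 0 < b -> a = 0.
    by move=> /eqP + b0; rewrite mulf_eq0 (gt_eqF b0) orbF => /eqP.
  have t12 : wedge (operiod o E) (operiod o' E') = 0 by apply: z0 TE''; lia.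
  have t31 : wedge (operiod o'' E'') (operiod o E) = 0 by apply: z0 TE'; lia.
  have p1 := ovec_operiod_gt0 o E; have p2 := ovec_operiod_gt0 o' E'.
  have p3 := ovec_operiod_gt0 o'' E''.
  rewrite -(dir _ _ _ t12) ?operiod_neq0 ?(same_dir t12 TE TE') // in p2.
  rewrite (dir _ _ _ t31) ?operiod_neq0 ?(same_dir t31 TE'' TE) // in p3.
  (* Now the periods have a common direction, with which all three vectors pair positively; Cramer's
     rule gives a sum of positive terms equal to zero. *)
  have := cramer (ovec o E) (ovec o' E') (ovec o'' E'') (L (operiod o E)).
  rewrite ![wedge (L _) _]wedgeC !mulrN.
  by have := mulr_gt0 xy p3; have := mulr_gt0 yz p1; have := mulr_gt0 zx p2; lra.
pose pos_c (oc : bool * Ce) := `[< exists E, cle E = oc.2 /\ 0 < wedge T (operiod oc.1 E) >].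
pose l := [seq (if oc.1 then vec_of oc.2 else - vec_of oc.2) | oc <- enum {: bool * Ce} & pos_c oc].
have [x|u uP] := half_plane (l := l) hP.
  move=> /mapP[[o c]]; rewrite mem_filter => /andP[/asboolP[E [/= Ec TE]] _] ->.
  by exists o, E; split; rewrite // /ovec (vec_ofP _ _ Ec).
exists (- u) => o E TE; rewrite wedgeNl oppr_lt0.
have -> : ovec o E = if o then vec_of (cle E) else - vec_of (cle E).
  by rewrite /ovec (vec_ofP _ _ erefl).
apply: uP; apply: (map_f (fun oc : bool * Ce => if oc.1 then vec_of oc.2 else - vec_of oc.2)
  (x := (o, cle E))).
by rewrite mem_filter mem_enum andbT; apply/asboolP; exists E.
Qed.

Theorem descending_loop i j : exists u, [/\ forall E, wedge u (vec E) != 0,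
  desc u j i & exists w, desc u (tr w i) j].
Proof.
have [T [T0 Tsep]] := separating_direction i j.
have [u uP] := descending_direction T0.
have u0 E : wedge u (vec E) != 0.
  have [[] /uP] := operiod_orient (T0 E); first by move=> /lt_eqF ->.
  by rewrite wedgeNr oppr_lt0 => /gt_eqF ->.
have up E : 0 < wedge T (period E) -> wedge u (vec E) < 0 by apply: (uP true).
have un E : wedge T (period E) < 0 -> 0 < wedge u (vec E).
  by move=> TE; have := uP false E; rewrite /= !wedgeNr !oppr_cp0; apply.
exists u; split=> //.
  apply: geodesic => E i1 j1.
    by apply/up/(Tsep true); rewrite /oside ?i1 ?j1.
  by apply: un; have := Tsep false E; rewrite /oside i1 j1 wedgeNr oppr_gt0; apply.
have [m0 m0P] := eventually_separated i j i T0; exists (T *+ m0).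
(* Hence every strip separating [j] from the translate of [i] is crossed in the sense of [T] on the
   way back: by monotonicity if [i] and [j] are on the same side, and by the choice of [m0]
   otherwise. *)
have key o E : 0 < wedge T (operiod o E) -> oside o E j -> oside o E (tr (T *+ m0) i).
  move=> TE sj; have [si|si] := boolP (oside o E i).
    exact: oside_trn_mono.
  by apply: m0P => //; apply: contraNneq si; rewrite /oside => ->.
apply: geodesic => E i1 j1.
  have [[] TE] := operiod_orient (T0 E); first exact: up.
  by have := key false E TE; rewrite /oside i1 j1 => /(_ isT).
have [[] TE] := operiod_orient (T0 E).
  by have := key true E TE; rewrite /oside i1 j1 => /(_ isT).
by apply: un; move: TE; rewrite wedgeNr oppr_gt0.
Qed.

End Strips.

(** * Coordinates and rhombi *)

Section RowPair.
Variable R : realType.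
Implicit Types x y : 'rV[R]_2.

Definition row_pair x : R * R := (x 0 0, x 0 1).

Lemma row_pairD x y : row_pair (x + y) = row_pair x + row_pair y.
Proof. by rewrite /row_pair !mxE. Qed.

Lemma row_pairB x y : row_pair (x - y) = row_pair x - row_pair y.
Proof. by rewrite /row_pair !mxE. Qed.

Lemma row_pair_inj : injective row_pair.
Proof.
move=> x y [x0 x1]; apply/rowP => i.
by case: (unliftP 0 i) => [j ->|->] //; rewrite [j]ord1 (_ : fintype.lift 0 0 = 1) //; apply: val_inj.
Qed.

Lemma det2_row_pair x y : det2 x y = wedge (row_pair x) (row_pair y).
Proof. by []. Qed.

Lemma length2_row_pair x : length2 x ^+ 2 = dot (row_pair x) (row_pair x).
Proof.
rewrite /length2 sqr_sqrtr; last by apply: sumr_ge0 => i _; apply: sqr_ge0.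
rewrite big_ord_recl big_ord1 (_ : fintype.lift 0 0 = 1) ?expr2 //; exact: val_inj.
Qed.

End RowPair.

(** The circles about [a] and [b] through the origin, of equal radius, meet again only at
    [a + b]. *)
Lemma rhombus_parallelogram (R : realFieldType) (a b h : R * R) :
  0 < wedge a b -> h != 0 -> dot b b = dot a a ->
  dot (a - h) (a - h) = dot a a -> dot (b - h) (b - h) = dot a a -> h = a + b.
Proof.
move=> ab h0 bb ah bh; set l := dot a a in bb ah bh *; set c := dot a b.
have ah' : 2 * dot a h = dot h h.
  apply/eqP; rewrite -subr_eq0; apply/eqP; transitivity (l - dot (a - h) (a - h)).
    by rewrite /l /dot /=; ring.
  by rewrite ah subrr.
have bh' : 2 * dot b h = dot h h.
  apply/eqP; rewrite -subr_eq0; apply/eqP; transitivity (dot b b - dot (b - h) (b - h)).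
    by rewrite /dot /=; ring.
  by rewrite bb bh subrr.
(* By Cramer's rule [D] times [h] is [X] times [a] plus [Y] times [b]. The equal lengths give
   [X = Y], and then [h != 0] gives [X = D]. *)
pose D := wedge a b; pose X := wedge h b; pose Y := wedge a h.
have lc : 0 < l - c.
  have ab0 : 0 < dot (a - b) (a - b).
    apply: dot_gt0; rewrite subr_eq0; apply: contraTneq ab => ->.
    by rewrite wedgexx ltxx.
  have : dot (a - b) (a - b) = l + dot b b - 2 * c by rewrite /l /c /dot /=; ring.
  by move: ab0 => + E; rewrite E bb; lra.
have XY : X = Y.
  have E1 : D * dot a h = X * l + Y * c by rewrite /D /X /Y /l /c /wedge /dot; ring.
  have E2 : D * dot b h = X * c + Y * dot b b by rewrite /D /X /Y /c /wedge /dot; ring.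
  have E3 : (X - Y) * (l - c) = 0.
    transitivity (D * dot a h - D * dot b h); first by rewrite E1 E2 bb; ring.
    have -> : dot a h = dot b h by lra.
    by rewrite subrr.
  by move/eqP: E3; rewrite mulf_eq0 [l - c == 0]gt_eqF // orbF subr_eq0 => /eqP.
have Dh1 : D * h.1 = X * (a.1 + b.1).
  have : D * h.1 = X * a.1 + Y * b.1 by rewrite /D /X /Y /wedge; ring.
  by rewrite -XY mulrDr.
have Dh2 : D * h.2 = X * (a.2 + b.2).
  have : D * h.2 = X * a.2 + Y * b.2 by rewrite /D /X /Y /wedge; ring.
  by rewrite -XY mulrDr.
have X0 : X != 0.
  apply: contraNneq h0 => X0; move: Dh1 Dh2; rewrite X0 !mul0r.
  move=> /eqP; rewrite mulf_eq0 gt_eqF //= => /eqP h1 /eqP.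
  rewrite mulf_eq0 gt_eqF //= => /eqP h2.
  by case: (h) h1 h2 => ? ? /= -> ->.
have s0 : 0 < dot (a + b) (a + b).
  apply: dot_gt0; apply: contraTneq ab => ab0.
  have -> : b = - a by apply/eqP; rewrite -addr_eq0 addrC ab0.
  by rewrite wedgeNr wedgexx oppr0 ltxx.
have XD : X = D.
  have E1 : D * D * dot h h = X * X * dot (a + b) (a + b).
    transitivity ((D * h.1) ^+ 2 + (D * h.2) ^+ 2); first by rewrite /dot; ring.
    by rewrite Dh1 Dh2 /dot /=; ring.
  have E2 : D * D * (2 * dot a h) = D * X * dot (a + b) (a + b).
    transitivity (2 * D * (a.1 * (D * h.1) + a.2 * (D * h.2))); first by rewrite /dot; ring.
    rewrite Dh1 Dh2; transitivity (D * X * (l + l + 2 * c)).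
      by rewrite /l /c /dot; ring.
    by rewrite -{2}bb /l /c /dot /=; ring.
  have : X * (X - D) * dot (a + b) (a + b) = 0.
    by rewrite mulrBr mulrBl -E1 [X * D]mulrC -E2 ah' subrr.
  move/eqP; rewrite !mulf_eq0 (negbTE X0) [dot _ _ == 0]gt_eqF // orbF /= subr_eq0.
  by move/eqP.
have D0 : D != 0 by rewrite gt_eqF.
move: Dh1 Dh2; rewrite XD => /(mulfI D0) h1 /(mulfI D0) h2.
by case: (h) h1 h2 => ? ? /= -> ->.
Qed.

(** * The rhombic tiling of the plane *)

Section Geometry.
Variables (R : realType) (Q : dimer_model) (U : universal_cover Q).
Variables (e1 e2 : 'rV[R]_2) (len : R).
Variable p : quad_vertex (U0 U) (Ublack U) (Uwhite U) -> 'rV[R]_2.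
Hypothesis emb : rhombic_embedding e1 e2 len p.

Local Notation Vx := (quad_vertex (U0 U) (Ublack U) (Uwhite U)).
Local Notation QV := (QuiverVertex (Ublack U) (Uwhite U)).
Local Notation BV := (BlackVertex (U0 U) (Uwhite U)).
Local Notation WV := (WhiteVertex (U0 U) (Ublack U)).
Implicit Types a c : U1 U.

Definition pos (x : Vx) : R * R := row_pair (p x).
Definition alpha a := pos (WV (wh U a)) - pos (QV (tl U a)).
Definition beta a := pos (BV (bl U a)) - pos (QV (tl U a)).

Lemma cell_uniq d d' x : open_cell U p d x -> open_cell U p d' x -> d = d'.
Proof.
by have [d0 [_ dP]] := cells_partition_plane emb x => /dP <- /dP <-.
Qed.

Lemma pos_inj : injective pos.
Proof.
move=> x y /row_pair_inj pxy.
have oc z : open_cell U p (Vertex _ z) (p z).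
  exists [:: 1]; split=> //=; first by rewrite ltr01.
    by rewrite big_seq1.
  by rewrite big_seq1 scale1r.
have := oc x; rewrite pxy => /cell_uniq/(_ (oc y)) [->] //.
Qed.

(** The midpoint depends on the two ends only, so edges with the same ends share a point and
    coincide. *)
Lemma edge_cell (x y : Vx) d : corners U d = [:: x; y] ->
  open_cell U p d (2^-1 *: p x + 2^-1 *: p y).
Proof.
move=> dE; exists [:: 2^-1; 2^-1]; rewrite dE; split=> //=.
- by rewrite invr_gt0 ltr0n.
- by rewrite !big_cons big_nil addr0; field.
- by rewrite !big_cons big_nil addr0.
Qed.

Lemma black_edge_inj a a' : bl U a = bl U a' -> hd U a = hd U a' -> a = a'.
Proof.
move=> ba ha; have := cell_uniq (@edge_cell _ _ (BlackEdge _ _ _ a) erefl)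
  (@edge_cell _ _ (BlackEdge _ _ _ a') _).
by rewrite /= -ba -ha => /(_ erefl) [].
Qed.

Lemma white_edge_inj a a' : wh U a = wh U a' -> hd U a = hd U a' -> a = a'.
Proof.
move=> ba ha; have := cell_uniq (@edge_cell _ _ (WhiteEdge _ _ _ a) erefl)
  (@edge_cell _ _ (WhiteEdge _ _ _ a') _).
by rewrite /= -ba -ha => /(_ erefl) [].
Qed.

Lemma proj_nextb a : proj (nextb U a) = nextb Q (proj a).
Proof. by have [[pb _] _ _ _ _] := proj_covering U; apply: pb. Qed.

Lemma proj_rot a : proj (rot U a) = rot Q (proj a).
Proof. by have [[_ pr] _ _ _ _] := proj_covering U; apply: pr. Qed.

Lemma proj_nextw a : proj (nextw U a) = nextw Q (proj a).
Proof. by rewrite !nextwE proj_rot proj_nextb. Qed.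

Lemma proj_surj q : exists a, proj (u := U) a = q.
Proof. by have [_ + _ _ _] := proj_covering U; apply. Qed.

(** Otherwise the black edges at the two ends of [a] would coincide, and the black face would have a
    single arrow, against [black_valence]. *)
Lemma hd_neq_tl a : hd U a <> tl U a.
Proof.
move=> ha; have [c ca] := nextb_surj U a.
have : a = c.
  by apply: black_edge_inj; [rewrite -ca bl_nextb|rewrite ha /hd ca].
move=> ac; apply: (@black_valence Q (proj a)).
by rewrite -proj_nextb -{2}ca -ac.
Qed.

Lemma wedge_alpha_beta a : 0 < wedge (alpha a) (beta a).
Proof.
have := quads_oriented emb a; rewrite det2_row_pair !row_pairB; exact.
Qed.

Lemma pos_length x y : length2 (p x - p y) = len -> dot (pos x - pos y) (pos x - pos y) = len ^+ 2.
Proof. by move=> <-; rewrite length2_row_pair row_pairB. Qed.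

Lemma pos_hd a : pos (QV (hd U a)) = pos (QV (tl U a)) + (alpha a + beta a).
Proof.
(* Quad edges are indexed by the arrow at whose head they end, so the two sides at the tail of [a]
   belong to its predecessors [c] and [d]. *)
have [c ca] := nextb_surj U a; have [d da] := nextw_surj U a.
have b1 := pos_length (black_edge_length emb a).
have b2 := pos_length (black_edge_length emb c).
have w1 := pos_length (white_edge_length emb a).
have w2 := pos_length (white_edge_length emb d).
rewrite -(tl_nextw U d) da -(wh_nextw U d) da in w2.
rewrite /hd ca -(bl_nextb U c) ca in b2.
have E x y z : (x - y) - (z - y) = x - z :> R * R by rewrite opprB addrA subrK.
suff <- : pos (QV (hd U a)) - pos (QV (tl U a)) = alpha a + beta a by rewrite addrC subrK.
apply: rhombus_parallelogram; first exact: wedge_alpha_beta.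
- rewrite subr_eq0; apply/eqP => /pos_inj [] h; exact: (hd_neq_tl h).
- by rewrite w2 b2.
- by rewrite E w2 w1.
- by rewrite E w2 b1.
Qed.

Lemma alpha_nextb a : alpha a = - beta (nextb U a).
Proof.
have E (x y z : R * R) : z = x + (z + (y - x)) - y.
  by case: x y z => [? ?] [? ?] [? ?]; congr pair; rewrite /=; ring.
by rewrite /beta bl_nextb -/(hd U a) pos_hd opprB /beta -E.
Qed.

Lemma beta_nextw a : beta a = - alpha (nextw U a).
Proof.
have E (x y z : R * R) : z = x + ((y - x) + z) - y.
  by case: x y z => [? ?] [? ?] [? ?]; congr pair; rewrite /=; ring.
by rewrite {1}/alpha wh_nextw tl_nextw pos_hd opprB /alpha -E.
Qed.

Lemma beta_rot a : 0 < wedge (beta a) (alpha (rot U a)).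
Proof.
have [c <-] := nextb_surj U a.
have -> : beta (nextb U c) = - alpha c by rewrite alpha_nextb opprK.
have -> : alpha (rot U (nextb U c)) = - beta c by rewrite -nextwE beta_nextw opprK.
by rewrite wedgeNl wedgeNr opprK wedge_alpha_beta.
Qed.

(** ** The lattice of deck translations *)
Lemma oriented_basis : exists b1 b2 : 'rV[R]_2, [/\ 0 < det2 b1 b2,
  forall g, deck g -> exists m n : int, acts_by_translation U p g (b1 *~ m + b2 *~ n) &
  forall m n : int, exists g, deck g /\ acts_by_translation U p g (b1 *~ m + b2 *~ n)].
Proof.
have := lattice_basis emb; rewrite neq_lt => /orP[d12|d12]; last first.
  exists e1, e2; split=> //; [exact: (deck_translation emb)|exact: (translation_deck emb)].
exists e2, e1; split.
- by move: d12; rewrite !det2_row_pair wedgeC oppr_lt0.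
- by move=> g /(deck_translation emb)[m [n H]]; exists n, m; rewrite addrC.
- by move=> m n; have [g H] := translation_deck emb n m; exists g; rewrite addrC.
Qed.

(** [kappa] is the area of a fundamental parallelogram. The action on vertices is found through
    positions, which determine vertices by [pos_inj]. *)
Lemma translations : exists (L : int * int -> R * R) (kappa : R),
  [/\ 0 < kappa, forall w w', L (w + w') = L w + L w',
      forall w w', wedge (L w) (L w') = kappa * (wedge w w')%:~R &
      exists (tr : int * int -> Vx -> Vx) (g : int * int -> U1 U -> U1 U),
      [/\ forall w, deck (g w), forall w x, pos (tr w x) = pos x + L w,
          forall w a, [/\ tr w (QV (tl U a)) = QV (tl U (g w a)),
                          tr w (BV (bl U a)) = BV (bl U (g w a)) &
                          tr w (WV (wh U a)) = WV (wh U (g w a))] &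
          forall a a', proj a = proj a' -> exists w, a' = g w a]].
Proof.
have [b1 [b2 [b12 deckT Tdeck]]] := oriented_basis.
pose L0 (w : int * int) := b1 *~ w.1 + b2 *~ w.2.
exists (fun w => row_pair (L0 w)), (det2 b1 b2); split=> //.
- by move=> w w'; rewrite -row_pairD /L0 !mulrzDr addrACA.
- move=> w w'; rewrite det2_row_pair /L0 /wedge /row_pair /= !mxE.
  rewrite -!scaler_int !mxE rmorphB !rmorphM /=; ring.
have /choice[g gP] : forall w, exists g, deck g /\ acts_by_translation U p g (L0 w).
  by move=> w; apply: Tdeck.
have gpos w a : [/\ pos (QV (tl U (g w a))) = pos (QV (tl U a)) + row_pair (L0 w),
    pos (BV (bl U (g w a))) = pos (BV (bl U a)) + row_pair (L0 w) &
    pos (WV (wh U (g w a))) = pos (WV (wh U a)) + row_pair (L0 w)].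
  by have [_ /(_ a)[Ht Hb Hw]] := gP w; rewrite /pos -!row_pairD Ht Hb Hw.
have /choice[tr trP] : forall w, exists f : Vx -> Vx,
    forall x, pos (f x) = pos x + row_pair (L0 w).
  move=> w; have /choice[f fP] : forall x, exists y, pos y = pos x + row_pair (L0 w).
    case=> [v|b|v]; [have [a <-] := tl_surj U v | have [a <-] := bl_surj U b |
      have [a <-] := wh_surj U v]; have [Ht Hb Hw] := gpos w a.
    - by exists (QV (tl U (g w a))).
    - by exists (BV (bl U (g w a))).
    - by exists (WV (wh U (g w a))).
  by exists f.
exists tr, g; split=> //.
- by move=> w; case: (gP w).
- by move=> w a; have [Ht Hb Hw] := gpos w a; split; apply: pos_inj; rewrite trP.
move=> a a' aa'.
(* Arrows with the same projection differ by a deck transformation, which is a translation by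
   assumption. *)
have [h [hT hb hp ha]] := covering_iso (proj_covering U) (proj_covering U)
  (@lift_connected _ U) (@lift_simply_connected _ U) (@lift_connected _ U) (@lift_simply_connected _ U) aa'.
have [m [n hmn]] := deckT h (And3 hT hb hp); exists (m, n).
have [_ _ inj _ _] := proj_covering U.
have [[_ _ gp] _] := gP (m, n); apply: inj; last by rewrite gp.
have [Ht _ _] := gpos (m, n) a; have [Hh _ _] := hmn a.
suff /pos_inj[] : pos (QV (tl U a')) = pos (QV (tl U (g (m, n) a))) by [].
by rewrite Ht -ha /pos Hh row_pairD.
Qed.

(** ** The edges of the quad graph *)

(* [(true, a)] runs from [tl a] to [wh a] and [(false, a)] from [bl a] to [tl a]:
   with these directions an edge has the same vector as the opposite one. *)
Definition edgeL (E : bool * U1 U) : Vx :=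
  if E.1 then QV (tl U E.2) else BV (bl U E.2).
Definition edgeR (E : bool * U1 U) : Vx :=
  if E.1 then WV (wh U E.2) else QV (tl U E.2).
Definition edge_next (E : bool * U1 U) : bool * U1 U :=
  if E.1 then (false, nextb U E.2) else (true, nextw U E.2).

Local Notation qadj := (adj edgeL edgeR).
Local Notation qvec := (vec edgeL edgeR pos).

Lemma qadj_sym x y : qadj x y -> qadj y x.
Proof. by case=> E [] [? ?]; exists E; [right|left]. Qed.

Lemma qadj_wh a : qadj (QV (tl U a)) (WV (wh U a)).
Proof. by exists (true, a); left. Qed.

Lemma qadj_bl a : qadj (QV (tl U a)) (BV (bl U a)).
Proof. by exists (false, a); right. Qed.

Lemma qadj_hd_wh a : qadj (WV (wh U a)) (QV (hd U a)).
Proof. by rewrite -tl_nextw -wh_nextw; apply/qadj_sym/qadj_wh. Qed.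

Lemma qadj_hd_bl a : qadj (BV (bl U a)) (QV (hd U a)).
Proof. by rewrite /hd -bl_nextb; apply/qadj_sym/qadj_bl. Qed.

Lemma qvec_true a : qvec (true, a) = alpha a. Proof. by []. Qed.
Lemma qvec_false a : qvec (false, a) = - beta a.
Proof. by rewrite /vec /beta opprB. Qed.

Lemma edge_next_inj : injective edge_next.
Proof.
move=> [[] a] [[] c]; rewrite /edge_next //= => -[E]; congr pair.
  exact: nextb_inj E.
exact: nextw_inj E.
Qed.

Lemma qvec_next E : qvec (edge_next E) = qvec E.
Proof.
case: E => [[] a]; rewrite /edge_next /=.
  by rewrite qvec_true qvec_false alpha_nextb.
by rewrite qvec_true qvec_false beta_nextw opprK.
Qed.

Lemma qadj_nextL E : qadj (edgeL E) (edgeL (edge_next E)).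
Proof.
case: E => [[] a]; rewrite /edgeL /edge_next /=.
  by rewrite bl_nextb; apply: qadj_bl.
by rewrite tl_nextw; apply: qadj_hd_bl.
Qed.

Lemma qadj_nextR E : qadj (edgeR E) (edgeR (edge_next E)).
Proof.
case: E => [[] a]; rewrite /edgeR /edge_next /=.
  exact: qadj_hd_wh.
by rewrite wh_nextw; apply: qadj_wh.
Qed.

Lemma wedge_edge_next E : 0 < wedge (qvec E) (pos (edgeL (edge_next E)) - pos (edgeL E)).
Proof.
case: E => [[] a]; rewrite /edgeL /edge_next /=.
  by rewrite bl_nextb qvec_true wedge_alpha_beta.
rewrite tl_nextw qvec_false pos_hd.
have -> : pos (QV (tl U a)) + (alpha a + beta a) - pos (BV (bl U a)) = alpha a.
  have E (x y z : R * R) : x + (z + (y - x)) - y = z.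
    by case: x y z => [? ?] [? ?] [? ?]; congr pair; rewrite /=; ring.
  by rewrite /beta E.
by rewrite wedgeNl wedgeC opprK wedge_alpha_beta.
Qed.

Lemma edge_inj E E' : edgeL E = edgeL E' -> edgeR E = edgeR E' -> E = E'.
Proof.
case: E E' => [[] a] [[] a'] //; rewrite /edgeL /edgeR /= => -[E1] [E2].
  have [c ca] := nextw_surj U a; have [c' ca'] := nextw_surj U a'.
  rewrite -ca -ca'; congr (_, nextw U _); apply: white_edge_inj.
    by rewrite -wh_nextw ca E2 -ca' wh_nextw.
  by rewrite -tl_nextw ca E1 -ca' tl_nextw.
have [c ca] := nextb_surj U a; have [c' ca'] := nextb_surj U a'.
rewrite -ca -ca'; congr (_, nextb U _); apply: black_edge_inj.
  by rewrite -bl_nextb ca E1 -ca' bl_nextb.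
by rewrite /hd ca E2 -ca'.
Qed.

Lemma quad_connected x y : exists n, reach edgeL edgeR n x y.
Proof.
have rcat m n x' y' z' : reach edgeL edgeR m x' y' -> reach edgeL edgeR n y' z' ->
    exists k, reach edgeL edgeR k x' z'.
  by move=> h1 h2; exists (m + n)%N; apply: reach_cat h1 h2.
have toQ z : exists v k, reach edgeL edgeR k z (QV v).
  case: z => [v|b|v]; first by exists v, 0%N.
    have [a <-] := bl_surj U b; exists (tl U a), 1%N; exists (QV (tl U a)) => //.
    exact/qadj_sym/qadj_bl.
  have [a <-] := wh_surj U v; exists (tl U a), 1%N; exists (QV (tl U a)) => //.
  exact/qadj_sym/qadj_wh.
have [v [k xv]] := toQ x; have [v' [k' yv']] := toQ y.
have [w vv'] := @lift_connected _ U v v'.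
have {w vv'}[m vv'] : exists m, reach edgeL edgeR m (QV v) (QV v').
  elim: w v vv' {xv} => [|s w IH] v /=; first by move=> ->; exists 0%N.
  (* An arrow is replaced by the two quad edges through its white vertex. *)
  move=> [<- /IH[m mP]]; exists m.+2; exists (WV (wh U s.2)); last first.
    exists (QV (step_dst U s)) => //; case: s {mP} => [[] a]; first exact: qadj_hd_wh.
    exact/qadj_sym/qadj_wh.
  case: s {mP} => [[] a]; first exact: qadj_wh.
  exact/qadj_sym/qadj_hd_wh.
have [n xv'] := rcat _ _ _ _ _ xv vv'.
exact: rcat xv' (reach_sym yv').
Qed.

(** [k a] is the increment from the tail to the head of [a] across its quad. By invariance its sums
    around faces telescope, so [closed_exact] gives the potential on quiver vertices; a dimer vertex
    takes its value from any adjacent corner. *)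
Lemma quad_cochain_exact (v0 : U0 U) (c : bool * U1 U -> int) :
  (forall E, c (edge_next E) = c E) ->
  exists g : Vx -> int, forall E, g (edgeR E) - g (edgeL E) = c E.
Proof.
move=> cz; pose k a := c (true, a) - c (false, a).
have cb a : c (true, a) = c (false, nextb U a) by rewrite -(cz (true, a)).
have cw a : c (false, a) = c (true, nextw U a) by rewrite -(cz (false, a)).
have [a n na|a n na|g gP] := closed_exact (k := k) (@lift_connected _ U) (@lift_simply_connected _ U) _ _ v0.
- rewrite (eq_bigr (fun a => c (false, nextb U a) - c (false, a))); last first.
    by move=> i _; rewrite /k cb.
  by rewrite (sum_traject (nextb U) (fun a => c (false, a))) na subrr.
- rewrite (eq_bigr (fun a => - (c (true, nextw U a) - c (true, a)))); last first.
    by move=> i _; rewrite /k cw opprB.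
  by rewrite sumrN (sum_traject (nextw U) (fun a => c (true, a))) na subrr oppr0.
have /choice[ab abP] := bl_surj U; have /choice[aw awP] := wh_surj U.
pose hb a := g (tl U a) - c (false, a); pose hw a := g (tl U a) + c (true, a).
have ghd a : g (hd U a) = g (tl U a) + k a by rewrite -gP addrC subrK.
have hbE a a' : bl U a = bl U a' -> hb a = hb a'.
  move=> /(blP U)[n <-]; elim: n => //= n ->; rewrite /hb -/(hd U _) ghd /k -cb; lia.
have hwE a a' : wh U a = wh U a' -> hw a = hw a'.
  move=> /(whP U)[n <-]; elim: n => //= n ->; rewrite /hw tl_nextw ghd /k -cw; lia.
exists (fun x => match x with QuiverVertex v => g v | BlackVertex b => hb (ab b)
  | WhiteVertex v => hw (aw v) end).
case=> [[] a]; rewrite /edgeL /edgeR /=.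
  by rewrite (hwE _ a) ?awP // /hw; lia.
by rewrite (hbE _ a) ?abP // /hb; lia.
Qed.

Lemma iter_bl n a : bl U (iter n (nextb U) a) = bl U a.
Proof. by elim: n => //= n IH; rewrite bl_nextb. Qed.

Lemma iter_wh n a : wh U (iter n (nextw U) a) = wh U a.
Proof. by elim: n => //= n IH; rewrite wh_nextw. Qed.

Lemma black_turn a : 0 < wedge (- beta a) (- beta (nextb U a)).
Proof. by rewrite -alpha_nextb wedgeNl wedgeC opprK wedge_alpha_beta. Qed.

Lemma white_turn a : wedge (- alpha a) (- alpha (nextw U a)) < 0.
Proof. by rewrite -beta_nextw wedgeNl oppr_lt0 wedge_alpha_beta. Qed.

Lemma quad_descend x u : u != 0 -> exists y, qadj x y /\ wedge u (pos y - pos x) < 0.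
Proof.
move=> u0; case: x => [v|b|v].
- have [a <-] := tl_surj U v.
  (* Quad edges around a quiver vertex end alternately at white and black vertices, so two steps of
     [f] make one of [rot]. *)
  pose f (E : bool * U1 U) := if E.1 then (false, E.2) else (true, rot U E.2).
  pose y (E : bool * U1 U) := if E.1 then alpha E.2 else beta E.2.
  have f2 n b c : iter (n * 2) f (b, c) = (b, iter n (rot U) c).
    by elim: n => //= n ->; case: b.
  have [[] | |n] := @left_cycle_negative _ _ f y u _ u0 _ (true, a).
  - move=> b c; have [n nc] := rot_orbit U c; exists (n * 2).+1.
    by rewrite -[_.+2](mulSn n 2) f2 nc.
  - by case=> [[] c]; rewrite /y /f /= ?wedge_alpha_beta ?beta_rot.
  have : exists c, tl U c = tl U a /\ (iter n f (true, a)).2 = c.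
    elim: n => [|n [c [tc cE]]]; first by exists a.
    rewrite iterS; case: (iter n f _) cE => [[] c'] /= ->; first by exists c.
    by exists (rot U c); rewrite tl_rot.
  move=> [c [<-]]; case: (iter n f _) => [[] c'] /= ->; rewrite /y /=.
    by exists (WV (wh U c)); split; first exact: qadj_wh.
  by exists (BV (bl U c)); split; first exact: qadj_bl.
- have [a <-] := bl_surj U b.
  have [n nP] := left_cycle_negative (nextb_orbit U) u0 black_turn a.
  exists (QV (tl U (iter n (nextb U) a))); rewrite -(iter_bl n a); split.
    exact/qadj_sym/qadj_bl.
  by move: nP; rewrite /beta opprB.
have [a <-] := wh_surj U v.
have [n nP] := right_cycle_negative (nextw_orbit U) u0 white_turn a.
exists (QV (tl U (iter n (nextw U) a))); rewrite -(iter_wh n a); split.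
  exact/qadj_sym/qadj_wh.
by move: nP; rewrite /alpha opprB.
Qed.

Lemma quad_descending_loop (i j : U0 U) : exists u,
  [/\ forall a, wedge u (alpha a) != 0 /\ wedge u (beta a) != 0,
      desc edgeL edgeR pos u (QV j) (QV i) &
      exists a a', [/\ tl U a = i, proj a = proj a' &
        desc edgeL edgeR pos u (QV (tl U a')) (QV j)]].
Proof.
have [L [kappa [k0 LD wedge_L [tr [g [gdeck pos_tr tr_g g_fibre]]]]]] := translations.
have gb w a : g w (nextb U a) = nextb U (g w a) by case: (gdeck w) => [[]].
have gr w a : g w (rot U a) = rot U (g w a) by case: (gdeck w) => [[]].
have gw w a : g w (nextw U a) = nextw U (g w a) by rewrite !nextwE gr gb.
have gp w a : proj (g w a) = proj a by case: (gdeck w).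
pose te w (E : bool * U1 U) := (E.1, g w E.2).
pose cle (E : bool * U1 U) := (E.1, proj E.2).
pose corner (k : option bool) a : Vx := match k with
  None => QV (tl U a) | Some true => BV (bl U a) | Some false => WV (wh U a) end.
have tr_corner w k a : tr w (corner k a) = corner k (g w a).
  by have [? ? ?] := tr_g w a; case: k => [[]|].
have /choice[ka kaP] : forall x : Vx, exists ka : option bool * U1 U, x = corner ka.1 ka.2.
  case=> [v|b|v]; [have [a <-] := tl_surj U v | have [a <-] := bl_surj U b |
    have [a <-] := wh_surj U v].
  - by exists (None, a).
  - by exists (Some true, a).
  - by exists (Some false, a).
(* The kind of a vertex together with the projection of a chosen arrow at it: equal classes give
   translates. *)
pose clv x := ((ka x).1, proj (ka x).2).
pose zQ (E : bool * Q1 Q) := if E.1 then (false, nextb Q E.2) else (true, nextw Q E.2).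
have zQ_inj : injective zQ.
  move=> [[] a] [[] c]; rewrite /zQ //= => -[E]; congr pair.
    exact: nextb_inj E.
  exact: nextw_inj E.
have cle_next E : cle (edge_next E) = zQ (cle E).
  by case: E => [[] a]; rewrite /cle /zQ /edge_next /= ?proj_nextb ?proj_nextw.
have [u [u0 ij [w ji]]] : exists u, [/\ forall E, wedge u (qvec E) != 0,
  desc edgeL edgeR pos u (QV j) (QV i) & exists w, desc edgeL edgeR pos u (tr w (QV i)) (QV j)].
  apply: (@descending_loop R Vx _ _ _ edgeL edgeR edge_next pos tr te L kappa clv cle) => //.
  - exact: quad_connected.
  - exact: quad_cochain_exact i.
  - exact: edge_next_inj.
  - exact: qvec_next.
  - exact: qadj_nextL.
  - exact: qadj_nextR.
  - exact: wedge_edge_next.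
  - exact: quad_descend.
  - exact: pos_inj.
  - exact: edge_inj.
  - by move=> w [[] a]; have [? ? ?] := tr_g w a.
  - by move=> w [[] a]; have [? ? ?] := tr_g w a.
  - by move=> w [[] a]; rewrite /te /edge_next /= ?gb ?gw.
  - move=> x y [k12 /g_fibre[w aw]]; exists w.
    by rewrite (kaP x) (kaP y) tr_corner -k12 aw.
  - by move=> [b a] [b' a'] [<- /g_fibre[w ->]]; exists w.
  - by move=> w [b a]; rewrite /cle /te /= gp.
  (* On classes the strip map is a permutation of a finite set; the predecessor of the order matches
     the exponent [n.+1]. *)
  - move=> E; exists (fingraph.order zQ (cle E)).-1.
    by rewrite prednK ?order_gt0 // (iter_comm cle_next) iter_order.
have [a ai] := tl_surj U i; exists u; split=> //.
  move=> a'; have := u0 (false, a'); rewrite qvec_false wedgeNr oppr_eq0; split=> //.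
  exact: u0 (true, a').
exists a, (g w a); split=> //.
have [<- _ _] := tr_g w a; by rewrite ai.
Qed.

(** ** The perfect matching of a direction *)
Lemma quad_point a (s t : R) : 0 < s < 1 -> 0 < t < 1 ->
  open_cell U p (Quad _ _ _ a) (p (QV (tl U a)) +
    s *: (p (WV (wh U a)) - p (QV (tl U a))) + t *: (p (BV (bl U a)) - p (QV (tl U a)))).
Proof.
move=> /andP[s0 s1] /andP[t0 t1].
have hdE : p (QV (hd U a)) = p (WV (wh U a)) + p (BV (bl U a)) - p (QV (tl U a)).
  apply: row_pair_inj; rewrite row_pairB row_pairD -!/(pos _) pos_hd /alpha /beta.
  by move: (pos _) (pos _) (pos _) => [? ?] [? ?] [? ?]; congr pair; rewrite /=; ring.
(* Bilinear weights: they give this point because the quad is a parallelogram. *)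
exists [:: (1 - s) * (1 - t); s * (1 - t); s * t; (1 - s) * t]; split=> //=.
- by rewrite !mulr_gt0 ?subr_gt0.
- by rewrite !big_cons big_nil; ring.
rewrite !big_cons big_nil /= hdE; apply/rowP => k; rewrite !mxE; ring.
Qed.

Section Direction.
Variable u : R * R.

Let ru : 'rV[R]_2 := \row_k (if k == 0 then u.1 else u.2).

Let row_pair_ru : row_pair ru = u.
Proof. by rewrite /row_pair !mxE; case: u. Qed.

Definition rises a := (0 < wedge u (alpha a)) && (0 < wedge u (beta a)).

(** [alpha a] and [- beta a] are the sides of the quad at its black vertex, so [u] points from there
    into the quad; likewise [- u] points into it from the white vertex. *)
Let coef a : exists s t : R, [/\ 0 < s, 0 < t &
  s *: (p (WV (wh U a)) - p (QV (tl U a))) - t *: (p (BV (bl U a)) - p (QV (tl U a))) = ru] \/ ~~ rises a.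
Proof.
have [/andP[ua ub]|] := boolP (rises a); last by exists 0, 0; right.
have D := wedge_alpha_beta a.
exists (wedge u (beta a) / wedge (alpha a) (beta a)),
  (wedge u (alpha a) / wedge (alpha a) (beta a)); left.
split; rewrite ?divr_gt0 //; apply: row_pair_inj; rewrite row_pair_ru.
move: D ua ub; rewrite /alpha /beta /pos -!row_pairB.
move: (_ - _) (_ - _) => y x; rewrite /row_pair /wedge /= !mxE.
move: (x 0 0) (x 0 1) (y 0 0) (y 0 1) => a1 a2 b1 b2 D _ _.
by case: u => u1 u2; congr pair; rewrite /=; field; rewrite gt_eqF.
Qed.

(** A short step from the black vertex in direction [u] ends in the open quads of both arrows. *)
Lemma rises_uniq_black a a' : rises a -> rises a' -> bl U a = bl U a' -> a = a'.
Proof.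
move=> ra ra' bb.
have [s [t [[s0 t0 st]|/negP//]]] := coef a.
have [s' [t' [[s'0 t'0 st']|/negP//]]] := coef a'.
(* The same step length keeps all four coefficients below 1. *)
pose e := (1 + s + t + s' + t')^-1.
have e0 : 0 < e by rewrite invr_gt0 !addr_gt0.
have small v : 0 < v -> v < 1 + s + t + s' + t' -> 0 < e * v < 1.
  by move=> v0 vl; rewrite mulr_gt0 //= mulrC ltr_pdivrMr ?mul1r // !addr_gt0.
have small1 v : 0 < e * v < 1 -> 0 < 1 - e * v < 1 by move=> /andP[? ?]; apply/andP; lra.
have [hs ht] : 0 < e * s < 1 /\ 0 < e * t < 1 by split; apply: small; lra.
have [hs' ht'] : 0 < e * s' < 1 /\ 0 < e * t' < 1 by split; apply: small; lra.
have q1 := quad_point a hs (small1 _ ht); have q2 := quad_point a' hs' (small1 _ ht').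
have E b x y v w : p (QV (tl U b)) + (e * v) *: (x - p (QV (tl U b))) +
   (1 - e * w) *: (y - p (QV (tl U b))) = y + e *: (v *: (x - p (QV (tl U b))) - w *: (y - p (QV (tl U b)))).
  by apply/rowP => k; rewrite !mxE; ring.
rewrite !E st st' bb in q1 q2.
by have [] := cell_uniq q1 q2.
Qed.

(** As for black vertices, with a short step in direction [- u] from the white vertex. *)
Lemma rises_uniq_white a a' : rises a -> rises a' -> wh U a = wh U a' -> a = a'.
Proof.
move=> ra ra' bb.
have [s [t [[s0 t0 st]|/negP//]]] := coef a.
have [s' [t' [[s'0 t'0 st']|/negP//]]] := coef a'.
pose e := (1 + s + t + s' + t')^-1.
have e0 : 0 < e by rewrite invr_gt0 !addr_gt0.
have small v : 0 < v -> v < 1 + s + t + s' + t' -> 0 < e * v < 1.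
  by move=> v0 vl; rewrite mulr_gt0 //= mulrC ltr_pdivrMr ?mul1r // !addr_gt0.
have small1 v : 0 < e * v < 1 -> 0 < 1 - e * v < 1 by move=> /andP[? ?]; apply/andP; lra.
have [hs ht] : 0 < e * s < 1 /\ 0 < e * t < 1 by split; apply: small; lra.
have [hs' ht'] : 0 < e * s' < 1 /\ 0 < e * t' < 1 by split; apply: small; lra.
have q1 := quad_point a (small1 _ hs) ht; have q2 := quad_point a' (small1 _ hs') ht'.
have E b x y v w : p (QV (tl U b)) + (1 - e * v) *: (x - p (QV (tl U b))) +
   (e * w) *: (y - p (QV (tl U b))) = x - e *: (v *: (x - p (QV (tl U b))) - w *: (y - p (QV (tl U b)))).
  by apply/rowP => k; rewrite !mxE; ring.
rewrite !E st st' bb in q1 q2.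
by have [] := cell_uniq q1 q2.
Qed.

End Direction.

Lemma alpha_beta_proj a a' : proj a = proj a' -> alpha a = alpha a' /\ beta a = beta a'.
Proof.
have [L [kappa [_ _ _ [tr [g [_ pos_tr tr_g g_fibre]]]]]] := translations.
move=> /g_fibre[w ->]; have [Et Eb Ew] := tr_g w a.
have E (x y l : R * R) : (x + l) - (y + l) = x - y by rewrite opprD addrACA subrr addr0.
by rewrite /alpha /beta -Et -Eb -Ew !pos_tr !E.
Qed.

Section Matching.
Variable u : R * R.
Hypothesis u_generic : forall a, wedge u (alpha a) != 0 /\ wedge u (beta a) != 0.

Definition arrow_lift (q : Q1 Q) : U1 U := projT1 (choice proj_surj) q.

Lemma arrow_liftK q : proj (arrow_lift q) = q.
Proof. exact: projT2 (choice proj_surj) q. Qed.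

Definition matching : {ffun Q1 Q -> nat} := [ffun q => nat_of_bool (rises u (arrow_lift q))].

Lemma matching_proj a : matching (proj a) = rises u a.
Proof.
by rewrite ffunE /rises; have [-> ->] := alpha_beta_proj (arrow_liftK (proj a)).
Qed.

(** The corner [tl a], seen from the black vertex, is to the left of [u]. An arrow rises when it
    leads from a corner not above to one above. *)
Definition above_black a := 0 < wedge u (- beta a).
Definition above_white a := 0 < wedge u (- alpha a).

Lemma rises_black a : rises u a = ~~ above_black a && above_black (nextb U a).
Proof.
rewrite /rises /above_black -alpha_nextb wedgeNr oppr_gt0 -leNgt le_eqVlt eq_sym.
by rewrite (negbTE (u_generic a).2) andbC.
Qed.

Lemma rises_white a : rises u a = ~~ above_white a && above_white (nextw U a).
Proof.
rewrite /rises /above_white -beta_nextw wedgeNr oppr_gt0 -leNgt le_eqVlt eq_sym.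
by rewrite (negbTE (u_generic a).1).
Qed.

Lemma bool_change (b : nat -> bool) k l : (k <= l)%N -> b k -> ~~ b l ->
  exists m, [/\ (k <= m < l)%N, b m & ~~ b m.+1].
Proof.
move=> /subnKC <-; elim: (l - k)%N => [|n IH] bk; first by rewrite addn0 bk.
rewrite addnS => bn; case bn' : (b (k + n)%N).
  by exists (k + n)%N; rewrite leq_addr leqnn bn'.
have [|m [/andP[km mn] bm bm1]] := IH bk; first by rewrite bn'.
by exists m; rewrite km (ltn_trans mn).
Qed.

Lemma cyclic_rise (A : Type) (f : A -> A) (chi : A -> bool) (a : A) :
  (forall c : A, exists n, iter n.+1 f c = c) ->
  (exists n, ~~ chi (iter n f a)) -> (exists n, chi (iter n f a)) ->
  exists k, ~~ chi (iter k f a) && chi (iter k.+1 f a).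
Proof.
move=> f_orb [n cn] [m cm]; have [N Na] := f_orb a.
have [|||k [_ ck ck1]] := @bool_change (fun k => ~~ chi (iter k f a)) n (m + n * N.+1).
- by rewrite mulnS addnCA leq_addr.
- exact: cn.
- by rewrite negbK iterD iter_fix.
by exists k; rewrite ck -[chi _]negbK.
Qed.

Lemma u_neq0 a : u != 0.
Proof. exact: wedge_neq0l (u_generic a).1. Qed.

(** The corners wind around the dimer vertex, so some are above it and some are not, and going
    around there is a change upwards. *)
Lemma black_rise a : exists k, rises u (iter k (nextb U) a).
Proof.
have [||k ck] := @cyclic_rise _ (nextb U) above_black a (nextb_orbit U).
- have [n nP] := left_cycle_negative (nextb_orbit U) (u_neq0 a) black_turn a.
  by exists n; rewrite /above_black -leNgt ltW.
- have [|n nP] := @left_cycle_negative _ _ _ _ (- u) (nextb_orbit U) _ black_turn a.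
    by rewrite oppr_eq0 (u_neq0 a).
  by exists n; move: nP; rewrite wedgeNl oppr_lt0.
by exists k; rewrite rises_black.
Qed.

Lemma white_rise a : exists k, rises u (iter k (nextw U) a).
Proof.
have [||k ck] := @cyclic_rise _ (nextw U) above_white a (nextw_orbit U).
- have [n nP] := right_cycle_negative (nextw_orbit U) (u_neq0 a) white_turn a.
  by exists n; rewrite /above_white -leNgt ltW.
- have [|n nP] := @right_cycle_negative _ _ _ _ (- u) (nextw_orbit U) _ white_turn a.
    by rewrite oppr_eq0 (u_neq0 a).
  by exists n; move: nP; rewrite wedgeNl oppr_lt0.
by exists k; rewrite rises_white.
Qed.

Lemma sum_one (I : finType) (P : pred I) (F : I -> nat) i :
  P i -> F i = 1%N -> (forall j, P j -> F j != 0%N -> j = i) -> (\sum_(j | P j) F j)%N = 1%N.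
Proof.
move=> Pi Fi uniq; rewrite (bigD1 i) //= Fi big1 ?addn0 // => j /andP[Pj ji].
by apply/eqP; apply: contraNT ji => /(uniq _ Pj) ->.
Qed.

Lemma perfect_matching_matching : perfect_matching matching.
Proof.
case=> [b|w] /=.
- have [q0 <-] := bl_surj Q b; have [a0 <-] := proj_surj q0.
  have [k rk] := black_rise a0; set a1 := iter k _ _ in rk.
  have b1 : bl Q (proj a1) = bl Q (proj a0).
    apply/esym/(blP Q); exists k.
    by rewrite -(iter_comm (g := nextb U) proj_nextb).
  apply: (@sum_one _ _ _ (proj a1)); first by rewrite b1.
    by rewrite matching_proj rk.
  move=> q; rewrite -b1 => /eqP/esym/(blP Q)[n]; rewrite -(iter_comm (g := nextb U) proj_nextb) => <-.
  rewrite matching_proj eqb0 negbK => rn; congr proj.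
  by apply: rises_uniq_black rn rk _; rewrite iter_bl.
have [q0 <-] := wh_surj Q w; have [a0 <-] := proj_surj q0.
have [k rk] := white_rise a0; set a1 := iter k _ _ in rk.
have b1 : wh Q (proj a1) = wh Q (proj a0).
  apply/esym/(whP Q); exists k.
  by rewrite -(iter_comm (g := nextw U) proj_nextw).
apply: (@sum_one _ _ _ (proj a1)); first by rewrite b1.
  by rewrite matching_proj rk.
move=> q; rewrite -b1 => /eqP/esym/(whP Q)[n]; rewrite -(iter_comm (g := nextw U) proj_nextw) => <-.
rewrite matching_proj eqb0 negbK => rn; congr proj.
by apply: rises_uniq_white rn rk _; rewrite iter_wh.
Qed.

(* Going around a face from a corner above its centre to one below, along a
   shortest arc, passes one falling pair of corners; a rising pair in between
   would require a second one. *)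
Lemma face_arc (A : Type) (f : A -> A) (chi : A -> bool) (a a' : A) :
  (exists n, iter n f a = a') -> chi a -> ~~ chi a' ->
  (forall k l, chi (iter k f a) -> ~~ chi (iter k.+1 f a) ->
     chi (iter l f a) -> ~~ chi (iter l.+1 f a) -> iter k f a = iter l f a) ->
  exists n, iter n f a = a' /\
    forall k, (k < n)%N -> ~~ chi (iter k f a) && chi (iter k.+1 f a) = false.
Proof.
move=> [n0 n0P] ca ca' down_uniq.
have ex : exists n, `[< iter n f a = a' >] by exists n0; apply/asboolP.
case: (ex_minnP ex) => n /asboolP na n_min; exists n; split=> // k kn.
apply/negP => /andP[ck ck1].
have [k1 [/andP[_ k1k] d1 d1']] := @bool_change (fun k => chi (iter k f a)) 0 k (leq0n _) ca ck.
have [|k2 [/andP[kk2 k2n] d2 d2']] := @bool_change (fun k => chi (iter k f a)) k.+1 n kn ck1.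
  by rewrite na.
have E := down_uniq _ _ d1 d1' d2 d2'.
have k12 : (k1 < k2)%N by apply: ltn_trans k1k kk2.
have : (n <= (n - k2) + k1)%N.
  apply/n_min/asboolP; rewrite iterD E -iterD subnK //; exact: ltnW.
apply/negP; rewrite -ltnNge; lia.
Qed.

Lemma eval_path_cat (s t : seq (U1 U)) :
  eval_path matching (s ++ t) = (eval_path matching s + eval_path matching t)%N.
Proof. by rewrite /eval_path big_cat. Qed.

Lemma oriented_path_cat i j k s t :
  oriented_path U i s j -> oriented_path U j t k -> oriented_path U i (s ++ t) k.
Proof.
by rewrite /oriented_path /forward map_cat => sj tk; apply/walk_cat; exists j.
Qed.

Lemma arc_path f n a : (forall c, tl U (f c) = hd U c) ->
  oriented_path U (tl U a) (traject f a n) (tl U (iter n f a)).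
Proof.
move=> tf; elim: n a => [//|n IH] a; split=> //.
by rewrite -[step_dst _ _]/(hd U a) -tf iterSr; apply: IH.
Qed.

Lemma arc_eval f n a : (forall k, (k < n)%N -> rises u (iter k f a) = false) ->
  eval_path matching (traject f a n) = 0%N.
Proof.
elim: n a => [|n IH] a h; first by rewrite /eval_path big_nil.
rewrite /eval_path /= big_cons matching_proj (h 0%N) //.
by apply: IH => k kn; rewrite -iterSr h.
Qed.

Definition avoiding i j := exists s, oriented_path U i s j /\ eval_path matching s = 0%N.

Lemma avoiding_trans i j k : avoiding i j -> avoiding j k -> avoiding i k.
Proof.
move=> [s [ij s0]] [t [jk t0]]; exists (s ++ t); split.
  exact: oriented_path_cat ij jk.
by rewrite eval_path_cat s0 t0.
Qed.

(** A fall for [u] is a rise for [- u], so the uniqueness of rises also bounds the number of falls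
    around a face. *)
Lemma falls_black a : above_black a -> ~~ above_black (nextb U a) -> rises (- u) a.
Proof.
rewrite /rises /above_black -alpha_nextb !wedgeNl !wedgeNr => ->.
by rewrite -leNgt le_eqVlt (negbTE (u_generic a).1) oppr_gt0 /= => ->.
Qed.

Lemma falls_white a : above_white a -> ~~ above_white (nextw U a) -> rises (- u) a.
Proof.
rewrite /rises /above_white -beta_nextw !wedgeNl !wedgeNr => ->.
by rewrite -leNgt le_eqVlt (negbTE (u_generic a).2) oppr_gt0 /= => ->.
Qed.

Lemma avoiding_black a a' : bl U a = bl U a' -> above_black a -> ~~ above_black a' ->
  avoiding (tl U a) (tl U a').
Proof.
move=> /(blP U) orb ca ca'; have [|n [<- nP]] := face_arc orb ca ca'.
  move=> k l dk dk' dl dl'; apply: (@rises_uniq_black (- u)); last by rewrite !iter_bl.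
    exact: falls_black dk dk'.
  exact: falls_black dl dl'.
exists (traject (nextb U) a n); split; first exact: arc_path.
by apply: arc_eval => k /nP; rewrite rises_black.
Qed.

Lemma avoiding_white a a' : wh U a = wh U a' -> above_white a -> ~~ above_white a' ->
  avoiding (tl U a) (tl U a').
Proof.
move=> /(whP U) orb ca ca'; have [|n [<- nP]] := face_arc orb ca ca'.
  move=> k l dk dk' dl dl'; apply: (@rises_uniq_white (- u)); last by rewrite !iter_wh.
    exact: falls_white dk dk'.
  exact: falls_white dl dl'.
exists (traject (nextw U) a n); split; first by apply: arc_path => c; rewrite tl_nextw.
by apply: arc_eval => k /nP; rewrite rises_white.
Qed.

Lemma desc_avoiding i j : desc edgeL edgeR pos u (QV j) (QV i) -> avoiding i j.
Proof.
(* A path through a dimer vertex enters from a corner above it and leaves to one below. The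
   invariant at a dimer vertex covers all corners above, as the arc around the face starts at the
   corner of entry. *)
move=> ij; pose P (x : Vx) := match x with
  | QuiverVertex v => avoiding v j
  | BlackVertex b => forall a, bl U a = b -> above_black a -> avoiding (tl U a) j
  | WhiteVertex w => forall a, wh U a = w -> above_white a -> avoiding (tl U a) j end.
rewrite -/(P (QV i)); elim: {i} ij => [|x y xy uxy _].
  by exists [::]; rewrite /eval_path big_nil.
case: xy uxy => [[[] a]] [] [<- <-]; rewrite /edgeL /edgeR /= => uxy IH.
- by apply: IH; rewrite // /above_white wedgeNr oppr_gt0.
- move=> c ca cup; apply: avoiding_trans IH; apply: avoiding_white => //.
  by rewrite /above_white -leNgt ltW // /alpha opprB.
- move=> c ca cup; apply: avoiding_trans IH; apply: avoiding_black => //.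
  by rewrite /above_black -leNgt ltW // /beta opprB.
- by apply: IH; rewrite // /above_black wedgeNr oppr_gt0.
Qed.

End Matching.

Lemma avoiding_loop (i j : U0 U) : exists m : {ffun Q1 Q -> nat},
  [/\ perfect_matching m,
      exists s, oriented_path U i s j /\ eval_path m s = 0%N &
      exists a a' s, [/\ tl U a = i, proj a = proj a',
        oriented_path U j s (tl U a') & eval_path m s = 0%N]].
Proof.
have [u [u0 ij [a [a' [ai aa' ji]]]]] := quad_descending_loop i j.
exists (matching u); split; first exact: perfect_matching_matching.
  exact: desc_avoiding ij.
by have [s [sP s0]] := desc_avoiding u0 ji; exists a, a', s.
Qed.

End Geometry.

(** * Vertices of the matching polygon *)
Section Faces.
Variables (R : realType) (Q : dimer_model).
Implicit Types (x y z : {ffun Q1 Q -> R}) (w : Q1 Q -> R) (m : {ffun Q1 Q -> nat}).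

Definition lin w x : R := \sum_q w q * x q.

Lemma lin_comb w n (c : 'I_n -> R) (y : 'I_n -> {ffun Q1 Q -> R}) :
  lin w [ffun a => \sum_k c k * y k a] = \sum_k c k * lin w (y k).
Proof.
rewrite /lin; under eq_bigr => q _ do rewrite ffunE mulr_sumr.
rewrite exchange_big; apply: eq_bigr => k _; rewrite mulr_sumr.
by apply: eq_bigr => q _; rewrite mulrCA.
Qed.

Lemma lin_segment w t y z :
  lin w [ffun a => t * y a + (1 - t) * z a] = t * lin w y + (1 - t) * lin w z.
Proof.
rewrite /lin !mulr_sumr -big_split; apply: eq_bigr => q _ /=.
by rewrite ffunE mulrDr !(mulrCA (w q)).
Qed.

Lemma linB w x y : lin w (x - y) = lin w x - lin w y.
Proof.
rewrite /lin -sumrB; apply: eq_bigr => q _.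
by rewrite !ffunE mulrBr.
Qed.

Definition invariant w := forall g : {ffun Q0 Q -> R}, lin w (d0 g) = 0.

Lemma lin_same_class w x y : invariant w -> same_class x y -> lin w x = lin w y.
Proof. by move=> wi [g xy]; apply/eqP; rewrite -subr_eq0 -linB xy wi. Qed.

(** The functionals are the columns of a cokernel of the matrix [D] of [d0]: they vanish on a row
    vector exactly when it lies in the row space of [D]. *)
Lemma class_coordinates : exists (n : nat) (w : 'I_n -> Q1 Q -> R),
  (forall k, invariant (w k)) /\
  forall x, (forall k, lin (w k) x = 0) -> exists g, x = d0 g.
Proof.
pose D : 'M[R]_(#|Q0 Q|, #|Q1 Q|) := \matrix_(i, k)
  ((hd Q (enum_val k) == enum_val i)%:R - (tl Q (enum_val k) == enum_val i)%:R).
pose row x : 'rV[R]_#|Q1 Q| := \row_k x (enum_val k).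
have rowD (g : {ffun Q0 Q -> R}) : row (d0 g) = (\row_i g (enum_val i)) *m D.
  have pick (v : Q0 Q) : \sum_(i < #|Q0 Q|) g (enum_val i) * (v == enum_val i)%:R = g v.
    rewrite (bigD1 (enum_rank v)) //= enum_rankK eqxx mulr1 big1 ?addr0 // => i iv.
    case: eqP => [vi|]; last by rewrite mulr0.
    by move: iv; rewrite vi enum_valK eqxx.
  apply/rowP => k; rewrite !mxE ffunE; under eq_bigr => i _ do rewrite !mxE mulrBr.
  by rewrite sumrB !pick.
have linE k x : lin (fun q => cokermx D (enum_rank q) k) x = (row x *m cokermx D) 0 k.
  rewrite mxE /lin (reindex (@enum_val _ (Q1 Q))) /=; last exact/onW_bij/enum_val_bij.
  by apply: eq_bigr => i _; rewrite !mxE enum_valK mulrC.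
exists #|Q1 Q|, (fun k q => cokermx D (enum_rank q) k); split=> [k g|x x0].
  by rewrite linE rowD -mulmxA mulmx_coker mulmx0 mxE.
have /submxP[v vD] : (row x <= D)%MS.
  by rewrite submxE; apply/eqP/rowP => k; rewrite -linE x0 mxE.
exists [ffun q => v 0 (enum_rank q)]; apply/ffunP => q.
have E : row x = row (d0 [ffun q => v 0 (enum_rank q)]).
  by rewrite rowD vD; congr (_ *m _); apply/rowP => i; rewrite mxE ffunE enum_valK.
by have := congr1 (fun r : 'rV_ _ => r 0 (enum_rank q)) E; rewrite !mxE enum_rankK.
Qed.

Lemma perfect_matching_le1 m q : perfect_matching m -> (m q <= 1)%N.
Proof.
by move=> /(_ (inl (bl Q q))) /= <-; rewrite (bigD1 q) //= leq_addr.
Qed.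

(* Among the perfect matchings on which a nonnegative class function vanishes,
   one of largest Euclidean norm in the class coordinates is extremal. *)
Lemma extremal_on_face w m0 : (forall q, 0 <= w q) -> invariant w ->
  perfect_matching m0 -> lin w (realify R m0) = 0 ->
  exists m, extremal R m /\ lin w (realify R m) = 0.
Proof.
move=> w0 wi m0P m00.
have [n [cw [cwi cwP]]] := class_coordinates.
pose ip x y := \sum_(k < n) lin (cw k) x * lin (cw k) y.
(* Perfect matchings take values 0 and 1, so they can be maximised over a finite type. *)
pose mb (b : {ffun Q1 Q -> bool}) : {ffun Q1 Q -> nat} := [ffun q => nat_of_bool (b q)].
have mbK m : perfect_matching m -> exists b, mb b = m.
  move=> mP; exists [ffun q => m q == 1%N]; apply/ffunP => q; rewrite !ffunE.
  by have := perfect_matching_le1 q mP; case: (m q) => [|[]].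
pose good b := `[< perfect_matching (mb b) /\ lin w (realify R (mb b)) = 0 >].
have [b0 b0E] := mbK _ m0P.
have good0 : good b0 by apply/asboolP; rewrite b0E.
case: (@Order.TotalTheory.arg_maxP _ R _ b0 good
  (fun b => ip (realify R (mb b)) (realify R (mb b))) good0) => b /asboolP[bP b00] bmax.
set x := realify R (mb b) in b00 bmax *.
have le_x m : perfect_matching m -> lin w (realify R m) = 0 ->
    ip x (realify R m) <= ip x x /\
    (ip x (realify R m) = ip x x -> forall k, lin (cw k) (realify R m) = lin (cw k) x).
  move=> mP m00'; have [c cE] := mbK _ mP; set y := realify R m.
  have yx : ip y y <= ip x x.
    by rewrite /y -cE; apply: bmax; apply/asboolP; rewrite cE.
  (* As [y] is no longer than [x], this square bounds [ip x y] by [ip x x], with equality only for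
     equal coordinates. *)
  have sq : \sum_(k < n) (lin (cw k) x - lin (cw k) y) ^+ 2 = ip x x + ip y y - 2 * ip x y.
    rewrite /ip mulr_sumr -big_split -sumrB; apply: eq_bigr => k _ /=; ring.
  have sq0 : 0 <= \sum_(k < n) (lin (cw k) x - lin (cw k) y) ^+ 2.
    by apply: sumr_ge0 => k _; apply: sqr_ge0.
  split; first by move: sq0; rewrite sq; lra.
  move=> e k; have : \sum_(k < n) (lin (cw k) x - lin (cw k) y) ^+ 2 = 0.
    by apply/le_anti; rewrite sq0 andbT sq e; lra.
  move=> /eqP; rewrite psumr_eq0 => [/allP/(_ k)|? _]; last exact: sqr_ge0.
  by rewrite mem_index_enum sqrf_eq0 subr_eq0 => /(_ isT)/eqP.
have realify_ge0 m : 0 <= lin w (realify R m).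
  by apply: sumr_ge0 => q _; rewrite mulr_ge0 // ffunE ler0n.
(* On the face where [w] vanishes, [ip x] is maximal at the class of [x] and nowhere else. Matchings
   off the face enter a convex combination on it with coefficient 0. *)
have face y : in_polygon y -> 0 <= lin w y /\ (lin w y = 0 -> ip x y <= ip x x /\
    (ip x y = ip x x -> same_class y x)).
  move=> [l [m [c [mP c0 c1 yc]]]].
  have wy : lin w y = \sum_k c k * lin w (realify R (m k)).
    by rewrite (lin_same_class wi yc) lin_comb.
  have cy j : lin (cw j) y = \sum_k c k * lin (cw j) (realify R (m k)).
    by rewrite (lin_same_class (cwi j) yc) lin_comb.
  have ipy : ip x y = \sum_k c k * ip x (realify R (m k)).
    rewrite /ip; under eq_bigr => j _ do rewrite cy mulr_sumr.
    rewrite exchange_big; apply: eq_bigr => k _; rewrite mulr_sumr.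
    by apply: eq_bigr => j _; rewrite mulrCA.
  split; first by rewrite wy; apply: sumr_ge0 => k _; rewrite mulr_ge0.
  rewrite wy => /eqP; rewrite psumr_eq0 => [/allP cw0|k _]; last by rewrite mulr_ge0.
  have c_or k : c k = 0 \/ lin w (realify R (m k)) = 0.
    have := cw0 k (mem_index_enum _); rewrite mulf_eq0 => /orP[] /eqP; auto.
  have ck k : c k * ip x (realify R (m k)) <= c k * ip x x.
    have [->|mk0] := c_or k; first by rewrite !mul0r.
    by rewrite ler_wpM2l //; have [] := le_x _ (mP k) mk0.
  have cx : ip x x = \sum_k c k * ip x x by rewrite -mulr_suml c1 mul1r.
  split; first by rewrite ipy cx; apply: ler_sum.
  move=> e; have ek k : c k * (ip x x - ip x (realify R (m k))) = 0.
    have : \sum_k c k * (ip x x - ip x (realify R (m k))) = 0.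
      under eq_bigr => i _ do rewrite mulrBr.
      by rewrite sumrB -cx -ipy e subrr.
    move=> /eqP; rewrite psumr_eq0 => [/allP/(_ k (mem_index_enum _))/eqP //|i _].
    by rewrite mulrBr subr_ge0.
  have [|g gP] := cwP (y - x); last by exists g.
  move=> j; rewrite linB cy; apply/eqP; rewrite subr_eq0; apply/eqP.
  rewrite -[RHS]mul1r -c1 mulr_suml; apply: eq_bigr => k _.
  have [->|mk0] := c_or k; first by rewrite !mul0r.
  have := ek k => /eqP; rewrite mulf_eq0 subr_eq0 => /orP[/eqP ->|/eqP/esym ek'].
    by rewrite !mul0r.
  by have [_ /(_ ek' j) ->] := le_x _ (mP k) mk0.
exists (mb b); split=> //; split=> //; split.
  exists 1%N, (fun _ => mb b), (fun _ => 1); split=> //.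
  - by rewrite big_ord1.
  - exists 0; apply/ffunP => q; rewrite !ffunE big_ord1 ?ffunE; ring.
move=> y z t yP zP /andP[t0 t1] xyz.
have [wy0 wyP] := face y yP; have [wz0 wzP] := face z zP.
have wx : t * lin w y + (1 - t) * lin w z = 0.
  by rewrite -lin_segment -(lin_same_class wi xyz).
have wy : lin w y = 0 by nra.
have wz : lin w z = 0 by nra.
have [iy iyP] := wyP wy; have [iz izP] := wzP wz.
have ix : ip x x = t * ip x y + (1 - t) * ip x z.
  rewrite {1}/ip; under eq_bigr => k _ do
    rewrite {2}(lin_same_class (cwi k) xyz) lin_segment mulrDr !(mulrCA (lin (cw k) x)).
  by rewrite big_split -!mulr_sumr.
split; [apply: iyP|apply: izP]; nra.
Qed.

End Faces.

(** * Paths under maps of tilings, and the conclusion *)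

Section Paths.
Variables (Q : dimer_model) (U : universal_cover Q).
Implicit Types (s : seq (U1 U)) (a c : U1 U).

Lemma tiling_map_tl (V A B W V' A' B' W' : Type) (T : tiling V A B W)
  (T' : tiling V' A' B' W') f : tiling_map T T' f ->
  forall a a' : A, tl T a = tl T a' -> tl T' (f a) = tl T' (f a').
Proof.
move=> [_ fr] a a' /(tlP T)[n <-]; apply/(tlP T'); exists n.
by rewrite (iter_comm (g := rot T) fr).
Qed.

Lemma oriented_path_map (U' : universal_cover Q) f s a c :
  tiling_map U U' f -> oriented_path U (tl U a) s (tl U c) ->
  oriented_path U' (tl U' (f a)) (map f s) (tl U' (f c)).
Proof.
move=> fT; elim: s a => [|b s IH] a; first exact: tiling_map_tl.
move=> [ba bs]; split; first exact: (tiling_map_tl fT ba).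
have := IH (nextb U b) bs; case: fT => fb _; rewrite fb; exact.
Qed.

Lemma sum_d0_path (M : zmodType) (g : {ffun Q0 Q -> M}) s a c :
  oriented_path U (tl U a) s (tl U c) ->
  \sum_(b <- s) d0 g (proj b) = g (tl Q (proj c)) - g (tl Q (proj a)).
Proof.
have [pT _ _ _ _] := proj_covering U.
elim: s a => [|b s IH] a.
  by move=> /(tiling_map_tl pT) ->; rewrite big_nil subrr.
move=> [ba /(IH (nextb U b)) E]; rewrite big_cons E ffunE proj_nextb.
by rewrite (tiling_map_tl pT ba) addrC addrA subrK.
Qed.

End Paths.

Theorem proposition1p2 (R : realType) (Q : dimer_model)
    (Qtorus : on_torus Q) (Qgc : geometrically_consistent R Q)
    (U : universal_cover Q) (i j : U0 U) :
  exists p : seq (U1 U), oriented_path U i p j /\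
    exists pi : {ffun Q1 Q -> nat}, extremal R pi /\ eval_path pi p = 0%N.
Proof.
case: Qgc => U' [e1 [e2 [len [p emb]]]].
have [a ai] := tl_surj U i; have [b bj] := tl_surj U j.
(* The embedding comes with its own universal cover [U'], so the vertices are carried there by an
   isomorphism and the path is carried back. *)
have [a' aa'] := proj_surj U' (proj a).
have [f [fT [g fK gK] fproj fa]] := covering_iso (proj_covering U) (proj_covering U')
  (@lift_connected _ U) (@lift_simply_connected _ U)
  (@lift_connected _ U') (@lift_simply_connected _ U') (esym aa').
have gT : tiling_map U' U g.
  by case: fT => fb fr; split=> c; apply: (can_inj fK); rewrite gK ?fb ?fr gK.
have gproj c : proj (g c) = proj c by rewrite -fproj gK.
have [m [mP [s [sP s0]] [c [c' [t [ca cc' tP t0]]]]]] :=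
  avoiding_loop emb (tl U' a') (tl U' (f b)).
(* [w] counts how often the projected path traverses each arrow. The path is closed in [Q], so this
   functional kills the image of [d0]. *)
pose w q : R := \sum_(d <- s ++ t) (proj d == q)%:R.
have linw x : lin w x = \sum_(d <- s ++ t) x (proj d).
  rewrite /lin /w; under eq_bigr => q _ do rewrite mulr_suml.
  rewrite exchange_big; apply: eq_bigr => d _.
  rewrite (bigD1 (proj d)) //= eqxx mul1r big1 ?addr0 // => q.
  by rewrite eq_sym => /negbTE ->; rewrite mul0r.
have linr (n : {ffun Q1 Q -> nat}) :
    lin w (realify R n) = (eval_path n s + eval_path n t)%:R.
  rewrite linw /eval_path -big_cat natr_sum.
  by apply: eq_bigr => d _; rewrite ffunE.
have [||//||pi [piP pi0]] := @extremal_on_face R Q w m.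
- by move=> q; apply: sumr_ge0 => d _; apply: ler0n.
- move=> h; rewrite linw big_cat (sum_d0_path h sP) (sum_d0_path h tP) -cc' /=.
  have [pT _ _ _ _] := proj_covering U'; rewrite (tiling_map_tl pT ca).
  by rewrite addrC addrA subrK subrr.
- by rewrite linr s0 t0.
exists (map g s); split.
  have := oriented_path_map gT sP; rewrite fK -fa fK ai bj; exact.
exists pi; split=> //; rewrite /eval_path big_map.
under eq_bigr => d _ do rewrite gproj.
(* The values on [s] and [t] are natural numbers with sum zero. *)
move/eqP: pi0; rewrite linr pnatr_eq0 addn_eq0 => /andP[/eqP + _]; exact.
Qed.
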